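(* For every $t \in \mathbb{N}$ there exists $c \in \mathbb{N}$ such that every graph $G \in \mathcal{X}_t$ that contains neither a pair of false twins nor a clique cutset of size at most $2$ is either a complete graph or satisfies $\mathrm{tw}(G) \le c$.
   Context: All graphs are finite and simple. For graphs $G_1=(V_1,E_1)$, $G_2=(V_2,E_2)$, $G_1\cap G_2=(V_1\cap V_2, E_1\cap E_2)$. For a graph $G=(V,E)$ and an injective map $\alpha$ on $V$, $G^{\alpha}$ has vertex set $\alpha(V)$ and edge set $\{\{\alpha(v),\alpha(w)\}: \{v,w\}\in E\}$. We write $G\xrightarrow{\cap} H$ if $H$ is (isomorphic to) $G^{\alpha_1}\cap\cdots\cap G^{\alpha_k}$ for some $k\ge1$ and injective maps $\alpha_1,\dots,\alpha_k$ on $V(G)$. For a set $M$ of graphs, $\mathrm{SiFree}(M)$ is the class of graphs $G$ such that $G\xrightarrow{\cap}F$ holds for no $F\in M$. For integers $a,b,c\ge1$, $S_{a,b,c}$ is the tree consisting of a vertex of degree $3$ together with three pendant paths (legs) having $a$, $b$, $c$ edges respectively; $tS_{t,t,t}$ is the disjoint union of $t$ copies of $S_{t,t,t}$, and $\mathcal{X}_t=\mathrm{SiFree}(\{tS_{t,t,t}\})$. Two distinct vertices $x,y$ are false twins if they are non-adjacent and $N(x)=N(y)$. A clique cutset is a (possibly empty) clique $U\subseteq V(G)$ such that $G-U$ is disconnected. $\mathrm{tw}$ denotes treewidth. *)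

(* Defs.v *)
(* Finite simple graphs are given as (T : finType, e : rel T)
   with e symmetric and irreflexive. *)
From mathcomp Require Import all_boot.
Set Implicit Arguments. Unset Strict Implicit. Unset Printing Implicit Defensive.

Section Graphs.
Variables (T : finType) (e : rel T).

(** ---- Intersections of injective images G^{alpha_1} ∩ ... ∩ G^{alpha_k} ----
   The injective maps alpha_i send V(G) into the common universe nat. *)

Definition isect_vert (k : nat) (alpha : 'I_k.+1 -> T -> nat) (n : nat) : Prop :=
  forall i, exists v, alpha i v = n.

Definition isect_edge (k : nat) (alpha : 'I_k.+1 -> T -> nat) (n m : nat) : Prop :=
  forall i, exists v w, e v w /\ alpha i v = n /\ alpha i w = m.

Definition si_arrow (U : finType) (f : rel U) : Prop :=
  exists (k : nat) (alpha : 'I_k.+1 -> T -> nat),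
    (forall i, injective (alpha i)) /\
    exists phi : U -> nat,
      [/\ injective phi,
          (forall n, isect_vert alpha n <-> exists u, phi u = n) &
          (forall u w, f u w <-> isect_edge alpha (phi u) (phi w))].

Definition false_twins (x y : T) : Prop :=
  x != y /\ ~~ e x y /\ forall z, e x z = e y z.

Definition is_clique (U : {set T}) : Prop :=
  forall x y, x \in U -> y \in U -> x != y -> e x y.

Definition disconnected_minus (U : {set T}) : Prop :=
  exists x y, [/\ x \notin U, y \notin U &
    ~~ connect [rel a b | [&& e a b, a \notin U & b \notin U]] x y].

Definition clique_cutset (U : {set T}) : Prop :=
  is_clique U /\ disconnected_minus U.

Definition complete_graph : Prop := forall x y, x != y -> e x y.

Definition is_tree (I : finType) (r : rel I) : Prop :=
  [/\ symmetric r, irreflexive r, 0 < #|I|,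
      (forall i j, connect r i j) &
      #|[set p : I * I | r p.1 p.2]| = 2 * (#|I| - 1)].

Definition tree_decomposition (I : finType) (r : rel I) (B : I -> {set T}) : Prop :=
  [/\ is_tree r,
      (forall v, exists i, v \in B i),
      (forall v w, e v w -> exists i, (v \in B i) && (w \in B i)) &
      (forall v i j, v \in B i -> v \in B j ->
         connect [rel a b | [&& r a b, v \in B a & v \in B b]] i j)].

Definition tw_le (c : nat) : Prop :=
  exists (I : finType) (r : rel I) (B : I -> {set T}),
    tree_decomposition r B /\ forall i, #|B i| <= c.+1.

End Graphs.

(** ---- the forbidden graph t S_{t,t,t} ----
   vertices: (copy c, None) = centre of copy c;
             (copy c, Some (j, i)) = (i+1)-th vertex of leg j of copy c. *)
Definition spider_vert (t : nat) : finType := ('I_t * option ('I_3 * 'I_t))%type.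

Definition spider_step (t : nat) (a b : option ('I_3 * 'I_t)) : bool :=
  match a, b with
  | None, Some (_, i) => val i == 0
  | Some (j, i), Some (j', i') => (j == j') && (val i' == (val i).+1)
  | _, _ => false
  end.

Definition spider_adj (t : nat) : rel (spider_vert t) :=
  fun x y => (x.1 == y.1) && (spider_step x.2 y.2 || spider_step y.2 x.2).

Definition in_X (t : nat) (T : finType) (e : rel T) : Prop :=
  ~ si_arrow e (@spider_adj t).

(* Main.v *)
(** Write H for tS_{t,t,t}.  The relation G -> H holds as soon as every
    non-adjacent pair (u, w) of H is "separable": some injective homomorphism
    H -> G sends u, w to non-adjacent vertices.

    - If G contains a big clique, take it maximal, of vertex set K.  A component
      of G - K has at least three neighbours in K, so it provides a vertex
      outside K with two or three disjoint paths to K; it is used as the image of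
      u, and a non-neighbour of it in K as the image of w.
    - If G contains a big induced biclique, take it maximal, with sides A and B.
      Pairs (u, w) that can be coloured alike are separable inside it.  For the
      other pairs one uses a vertex complete to A with a neighbour in B, or a
      component outside A and B with two neighbours in A, or two in B; otherwise
      there is a clique cutset of size at most 2, or there are false twins.
    - If G has neither, it has no big biclique as a subgraph, by Ramsey's theorem.
      Then many disjoint long spiders make every pair separable: if u and w are
      adjacent in all embeddings, the chords obtained in this way give new spiders
      inside the old ones, hence new chords, until they form a big biclique.
    - Finally, if G does not contain many disjoint long spiders, deleting a
      maximal packing leaves a graph without long spiders; there, a search along
      a path has at most 3n + 1 path vertices attached to the remaining component,
      which yields a tree decomposition of bounded width. *)
Require Import Defs.
From mathcomp Require Import all_boot zify.
From Stdlib Require Import Classical_Prop.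
Set Implicit Arguments. Unset Strict Implicit. Unset Printing Implicit Defensive.

(** * Intersections and embeddings *)

Definition embedding (T U : finType) (e : rel T) (f : rel U) (g : U -> T) : Prop :=
  injective g /\ forall u w, f u w -> e (g u) (g w).

(** Take one copy of the host graph per embedding, labelled so that the images of each vertex of [U]
    coincide and no other vertex is common to all copies. A pair then survives as an edge iff every
    embedding sends it to an edge, which the separating embeddings exclude for non-adjacent
    pairs. *)
Lemma si_arrow_of_embeddings (T U : finType) (e : rel T) (f : rel U) :
  irreflexive e ->
  (exists g, embedding e f g) ->
  (forall u w, u != w -> ~~ f u w ->
     exists g, embedding e f g /\ ~~ e (g u) (g w)) ->
  si_arrow e f.
Proof.
move=> e_irr [g0 [g0_inj g0_hom]] sep.
pose isemb (g : {ffun U -> T}) :=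
  injectiveb g && [forall u, forall w, f u w ==> e (g u) (g w)].
have isembP (g : U -> T) : embedding e f g -> isemb (finfun g).
  case=> g_inj g_hom; apply/andP; split.
    by apply/injectiveP => x y; rewrite !ffunE => /g_inj.
  by apply/forallP => u; apply/forallP => w; apply/implyP; rewrite !ffunE; apply: g_hom.
pose S := enum isemb.
(* Two indices beyond the list [S] repeat the default [g0]: at least two copies are needed to get
   rid of the vertices outside the images. *)
pose F (i : 'I_(size S).+2) := nth (finfun g0) S i.
have F_emb i : isemb (F i).
  rewrite /F; have [lt_i|ge_i] := ltnP i (size S).
    by have := mem_nth (finfun g0) lt_i; rewrite mem_enum.
  by rewrite nth_default //; apply: isembP.
have F_inj i : injective (F i) by apply/injectiveP; case/andP: (F_emb i).
have F_hom i u w : f u w -> e (F i u) (F i w).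
  by case/andP: (F_emb i) => _ /forallP/(_ u)/forallP/(_ w)/implyP.
have F_all g : isemb g -> exists i, F i = g.
  move=> g_emb; have g_S : g \in S by rewrite mem_enum.
  have lt_g : index g S < (size S).+2 by rewrite ltnW // ltnS ltnW // ltnS index_mem.
  by exists (Ordinal lt_g); rewrite /F /= nth_index.
(* Vertices outside the image of [F i] get numbers from a block above [#|U|] that belongs to copy
   [i] alone. *)
pose alpha (i : 'I_(size S).+2) (v : T) : nat :=
  if [pick u | F i u == v] is Some u then enum_rank u
  else #|U| + (i * #|T| + enum_rank v).
have alphaF i u : alpha i (F i u) = enum_rank u.
  rewrite /alpha; case: pickP => [u' /eqP /F_inj -> //|/(_ u)].
  by rewrite eqxx.
have alpha_small i v (u : U) : alpha i v = enum_rank u -> v = F i u.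
  rewrite /alpha; case: pickP => [u' /eqP <- /val_inj /enum_rank_inj -> //|_ h].
  by have := ltn_ord (enum_rank u); rewrite -h ltnNge leq_addr.
exists (size S).+1, alpha; split.
  move=> i v v'; rewrite {1}/alpha; case: pickP => [u /eqP <- h|_].
    by rewrite -(alpha_small i v' u).
  rewrite /alpha; case: pickP => [u /eqP <- h|_ /addnI /addnI /val_inj /enum_rank_inj //].
  by have := ltn_ord (enum_rank u); rewrite -h ltnNge leq_addr.
exists (fun u : U => enum_rank u : nat); split.
- by move=> u u' /val_inj /enum_rank_inj.
- move=> n; split; last by case=> u <- i; exists (F i u); rewrite alphaF.
  move=> h; have [v0 h0] := h ord0; have [v1 h1] := h (Ordinal (isT : 1 < (size S).+2)).
  move: h0; rewrite /alpha; case: pickP => [u _ <-|_ h0]; first by exists u.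
  move: h1; rewrite /alpha; case: pickP => [u _ <-|_ h1]; first by exists u.
  have lt0 : enum_rank v0 < #|T| by exact: ltn_ord.
  exfalso; move: lt0 h0 h1; rewrite /= mul0n mul1n.
  move: #|T| #|U| (nat_of_ord (enum_rank v0)) (nat_of_ord (enum_rank v1)); clear; lia.
- move=> u w; split.
    by move=> fuw i; exists (F i u), (F i w); rewrite !alphaF; split=> //; apply: F_hom.
  move=> h; apply/negPn/negP => nfuw.
  have Fe i : e (F i u) (F i w).
    by have [v [v' [evv' [/alpha_small <- /alpha_small <-]]]] := h i.
  have [Euw|neq] := eqVneq u w.
    by have := Fe ord0; rewrite Euw e_irr.
  have [g [g_emb /negP]] := sep u w neq nfuw; apply.
  have [i Fi] := F_all _ (isembP _ g_emb).
  by have := Fe i; rewrite Fi !ffunE.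
Qed.

(* A cell prescribes the image of a vertex: [inl a] fixes it to be [a],
   [inr K] leaves it free in [K]. *)
Definition in_cell (T : finType) (a : T) (c : T + {set T}) : bool :=
  match c with inl b => a == b | inr K => a \in K end.

Definition compatible (T : finType) (e : rel T) (c d : T + {set T}) : Prop :=
  forall a b, in_cell a c -> in_cell b d -> a != b -> e a b.

(** Free cells are filled one after another: as long as some vertex is free, fewer than [#|U|]
    values are prescribed, so a cell with [#|U|] elements has a new one. *)
Lemma cell_choice (T U : finType) (C : U -> T + {set T}) :
  (forall z z' a, C z = inl a -> C z' = inl a -> z = z') ->
  (forall z K, C z = inr K -> #|U| <= #|K|) ->
  exists g : U -> T, injective g /\ forall z, in_cell (g z) (C z).
Proof.
pose free (D : U -> T + {set T}) := [set z | if D z is inr _ then true else false].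
have [n] := ubnP #|free C|; elim: n C => // n IHn C /ltnSE le_n C_inj C_big.
have [free0|/set0Pn[z]] := eqVneq (free C) set0.
  have fixed z : exists a, C z == inl a.
    case Ez: (C z) => [a|K]; first by exists a.
    have : z \in free C by rewrite inE Ez.
    by rewrite free0 inE.
  exists (fun z => xchoose (fixed z)); split=> [z z' Ez|z].
    apply: (C_inj z z' (xchoose (fixed z))); first exact/eqP/(xchooseP (fixed z)).
    by rewrite Ez; apply/eqP/(xchooseP (fixed z')).
  by move: (xchoose _) (xchooseP (fixed z)) => a /eqP ->; rewrite /= eqxx.
rewrite inE; case Ez: (C z) => [//|K] _.
pose used := [set a | [exists z', C z' == inl a]].
have lt_used : #|used| < #|U|.
  pose val_of z' := if C z' is inl a then Some a else None.
  have sub : [set Some a | a in used] \subset [set val_of z' | z' in [set~ z]].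
    apply/subsetP => o /imsetP[a]; rewrite inE => /existsP[z' /eqP Ez'] ->.
    apply/imsetP; exists z'; last by rewrite /val_of Ez'.
    by rewrite !inE; apply/eqP => E; rewrite E Ez in Ez'.
  have := leq_trans (subset_leq_card sub) (leq_imset_card _ _).
  rewrite card_imset; last by move=> a b [].
  rewrite cardsC1 => /leq_ltn_trans; apply.
  by rewrite ltn_predL; apply/card_gt0P; exists z.
have [a aK a_new] : exists2 a, a \in K & a \notin used.
  apply/subsetPn/negP => /subset_leq_card.
  by rewrite leqNgt (leq_trans lt_used) // (C_big z).
have {}a_new z' : C z' <> inl a.
  by move=> Ez'; case/negP: a_new; rewrite inE; apply/existsP; exists z'; apply/eqP.
pose D z' := if z' == z then inl a else C z'.
have [|z1 z2 b|z' L|g [g_inj g_in]] := IHn D.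
- apply: leq_trans le_n; apply: proper_card; apply/properP; split.
    by apply/subsetP => z'; rewrite !inE /D; case: eqP.
  by exists z; rewrite !inE ?Ez // /D eqxx.
- rewrite /D; do 2!case: eqP => [->|_] //.
  + by case=> <- /a_new.
  + by move=> + [Eb]; rewrite -Eb => /a_new.
  + exact: C_inj.
- by rewrite /D; case: eqP => // _; apply: C_big.
exists g; split=> // z'; have := g_in z'; rewrite /D; case: eqP => // -> /eqP ->.
by rewrite Ez.
Qed.

Lemma spider_step_irr t : irreflexive (@spider_step t).
Proof. by case=> [[j a]|] //=; rewrite eqn_leq ltnn !andbF. Qed.

Lemma spider_adj_sym t : symmetric (@spider_adj t).
Proof. by move=> x y; rewrite /spider_adj eq_sym orbC. Qed.

Lemma spider_embedding_of_cells t (T : finType) (e : rel T)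
    (C : spider_vert t -> T + {set T}) :
  symmetric e ->
  (forall z z' a, C z = inl a -> C z' = inl a -> z = z') ->
  (forall z K, C z = inr K -> #|{: spider_vert t}| <= #|K|) ->
  (forall i v v', spider_step v v' -> compatible e (C (i, v)) (C (i, v'))) ->
  exists g, embedding e (@spider_adj t) g /\ forall z, in_cell (g z) (C z).
Proof.
move=> e_sym C_inj C_big C_step; have [g [g_inj g_in]] := cell_choice C_inj C_big.
exists g; split=> //; split=> // -[i v] [i' v']; rewrite /spider_adj /=.
case/andP => /eqP <-; have neq w w' : spider_step w w' -> g (i, w) != g (i, w').
  move=> st; apply/eqP => /g_inj [Ew]; by rewrite Ew spider_step_irr in st.
case/orP=> st; first by apply: (C_step i v v' st); rewrite ?g_in ?neq.
by rewrite e_sym; apply: (C_step i v' v st); rewrite ?g_in ?neq.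
Qed.

(** * Embeddings of spiders that use a clique or a biclique *)

Definition depth (t : nat) (v : option ('I_3 * 'I_t)) : nat :=
  if v is Some (_, b) then b.+1 else 0.

(** The part of leg [j] of copy [i] from the vertex [(i, Some (j, a))] out to the tip, that vertex
    included. *)
Definition outward (t : nat) (i : 'I_t) (j : 'I_3) (a : 'I_t) (z : spider_vert t) : bool :=
  if z.2 is Some (j', b) then [&& z.1 == i, j' == j & a <= b] else false.

(** Covers two cases at once: a clique, with [h] constant, and a biclique, with [h] giving its
    sides. *)
Definition host (T : finType) (e : rel T) (h : bool -> {set T}) : Prop :=
  forall c, compatible e (inr (h c)) (inr (h (~~ c))).

(** Cells of a leg that starts at [x], runs along the path [s] and then continues freely in the
    host. The parities are such that position [size s], the end of the path, belongs to [h c]. *)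
Definition ray (T : finType) (h : bool -> {set T}) (c : bool) (x : T) (s : seq T) (n : nat)
    : T + {set T} :=
  if n <= size s then inl (nth x (x :: s) n) else inr (h (c (+) odd n (+) odd (size s))).

Lemma in_ray_last (T : finType) (h : bool -> {set T}) c x s n a :
  last x s \in h c -> size s <= n -> in_cell a (ray h c x s n) ->
  a \in h (c (+) odd n (+) odd (size s)).
Proof.
rewrite /ray leq_eqVlt => last_h /orP[/eqP En|lt_n]; last by rewrite leqNgt lt_n.
by rewrite -En leqnn /= (addbK (odd (size s)) c) -[size s]/((size (x :: s)).-1) nth_last /= => /eqP ->.
Qed.

Lemma ray_inl (T : finType) (h : bool -> {set T}) c x s n a :
  ray h c x s n = inl a -> n <= size s /\ a = nth x (x :: s) n.
Proof. by rewrite /ray; case: leqP => // le_n [<-]. Qed.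

Lemma ray_compatible (T : finType) (e : rel T) (h : bool -> {set T}) c x s n :
  host e h -> path e x s -> last x s \in h c ->
  compatible e (ray h c x s n) (ray h c x s n.+1).
Proof.
move=> h_host s_path s_last a b; have [lt_n|le_n] := ltnP n (size s).
  rewrite /ray lt_n (ltnW lt_n) /= => /eqP -> /eqP -> _.
  exact: (pathP x s_path).
move=> /(in_ray_last s_last le_n) a_h /(in_ray_last s_last (leqW le_n)) b_h.
by apply: (h_host _ _ _ a_h); move: b_h; rewrite /= addbN addNb.
Qed.

Lemma spider_step_depth t (v v' : option ('I_3 * 'I_t)) :
  spider_step v v' -> depth v' = (depth v).+1.
Proof.
by case: v v' => [[j b]|] [[j' b']|] //= => [/andP[_ /eqP ->]|/eqP ->].
Qed.

Lemma spider_step_pred_uniq t (v v' u : option ('I_3 * 'I_t)) :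
  spider_step v u -> spider_step v' u -> v = v'.
Proof.
case: v v' u => [[j b]|] [[j' b']|] [[j'' b'']|] //=.
- move=> /andP[/eqP -> /eqP Eb] /andP[/eqP -> /eqP Eb'].
  by congr (Some (_, _)); apply/val_inj; apply: succn_inj; rewrite -Eb.
- by move=> /andP[_ /eqP E] /eqP E'; have := etrans (esym E') E.
- by move=> /eqP E /andP[_ /eqP E']; have := etrans (esym E) E'.
Qed.

Lemma outward_step t (i i0 : 'I_t) j a v v' :
  spider_step v v' -> outward i j a (i0, v) -> outward i j a (i0, v').
Proof.
case: v v' => [[j1 b]|] [[j' b']|] //= /andP[/eqP <- /eqP Eb] /and3P[Ei Ej le_b].
by rewrite /outward /= in Ei Ej *; rewrite Ei Ej /= Eb leqW.
Qed.

Lemma outward_root t (i i0 : 'I_t) j a v v' :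
  spider_step v v' -> ~~ outward i j a (i0, v) -> outward i j a (i0, v') ->
  i0 = i /\ v' = Some (j, a).
Proof.
rewrite /outward; case: v v' => [[j1 b]|] [[j' b']|] //=.
  move=> /andP[/eqP <- /eqP Eb] nout /and3P[/eqP Ei /eqP Ej le_a].
  move: nout; rewrite Ei Ej !eqxx /= -ltnNge => lt_b; split=> //; congr (Some (_, _)).
  by apply/ord_inj/eqP; rewrite eqn_leq le_a Eb lt_b.
move=> /eqP Eb _ /and3P[/eqP -> /eqP -> /= le_a]; split=> //.
by congr (Some (_, _)); apply/ord_inj/eqP; rewrite eqn_leq le_a Eb.
Qed.

Lemma outward_depth t (i : 'I_t) j a z :
  outward i j a z -> a < depth z.2 /\ forall z', outward i j a z' ->
  depth z.2 = depth z'.2 -> z = z'.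
Proof.
case: z => i0 [[j1 b]|] //=; rewrite /outward /= => /and3P[/eqP -> /eqP -> le_a].
split=> // -[i1 [[j2 b']|]] //= /and3P[/eqP -> /eqP -> _] [Eb].
by congr (_, Some (_, _)); apply: val_inj.
Qed.

(** The vertex [(i, Some (j, a))] goes to [x], its inner neighbour to [k1], the rest of its leg
    along [s] into the host, and [w] to the non-neighbour [y] of [x]. All other vertices are free in
    the host, on the side given by the parity of their depth, shifted by [k]. *)
Lemma leg_embedding t (T : finType) (e : rel T) (h : bool -> {set T}) c k x s k1 y
    (i : 'I_t) (j : 'I_3) (a : 'I_t) (w : spider_vert t) :
  symmetric e -> host e h -> (forall b, #|{: spider_vert t}| <= #|h b|) ->
  path e x s -> last x s \in h c -> uniq [:: k1, y, x & s] ->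
  e x k1 -> ~~ e x y ->
  k1 \in h (k (+) odd a) -> y \in h (k (+) odd (depth w.2)) ->
  ~~ spider_adj (i, Some (j, a)) w -> ~~ outward i j a w ->
  exists g, embedding e (@spider_adj t) g /\ ~~ e (g (i, Some (j, a))) (g w).
Proof.
move=> e_sym h_host h_big s_path s_last uniq_s exk1 nexy k1_h y_h nadj nout.
set u := (i, Some (j, a)).
pose inner z := (z.1 == i) && spider_step z.2 u.2.
pose C z := if outward i j a z then ray h c x s (depth z.2 - a.+1)
  else if inner z then inl k1 else if z == w then inl y
  else inr (h (k (+) odd (depth z.2))).
have inner_uniq z z' : inner z -> inner z' -> z = z'.
  case: z z' => [i1 v] [i2 v'] /andP[/eqP /= -> st] /andP[/eqP /= -> st'].
  by congr (_, _); apply: spider_step_pred_uniq st st'.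
move: (uniq_s); rewrite [uniq _]/(_ && (_ && uniq (x :: s))).
rewrite inE negb_or => /andP[/andP[k1y k1s] /andP[ys xs_uniq]].
have nth_s n : n <= size s -> nth x (x :: s) n \in x :: s by move=> le_n; apply: mem_nth.
have out_u : outward i j a u by rewrite /outward /= !eqxx leqnn.
have Cu : C u = inl x by rewrite /C out_u /= subnn.
have Cw : C w = inl y.
  rewrite /C (negPf nout) eqxx; case: ifP => // /andP[/eqP Ew st].
  by case/negP: nadj; rewrite /spider_adj /= Ew eqxx st orbT.
have C_inj z z' v : C z = inl v -> C z' = inl v -> z = z'.
  rewrite /C; case: ifP => [out_z /ray_inl[le_z Ev]|_].
    case: ifP => [out_z' /ray_inl[le_z' Ev']|_].
      have [lt_z eq_z] := outward_depth out_z.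
      have [lt_z' _] := outward_depth out_z'.
      move: Ev; rewrite {}Ev' => /eqP; rewrite nth_uniq // => /eqP Ed.
      by apply: eq_z => //; move: Ed lt_z lt_z'; clear; lia.
    case: ifP => [_ [Ek]|_]; first by case/negP: k1s; rewrite Ek Ev nth_s.
    by case: eqP => // _ [Ey]; case/negP: ys; rewrite Ey Ev nth_s.
  case: ifP => [inn_z [Ek]|_].
    case: ifP => [out_z' /ray_inl[le_z' Ev']|_]; first by case/negP: k1s; rewrite Ek Ev' nth_s.
    case: ifP => [inn_z' _|_]; first exact: inner_uniq.
    by case: eqP => // _ [Ey]; rewrite Ek Ey eqxx in k1y.
  case: eqP => // -> [Ey].
  case: ifP => [out_z' /ray_inl[le_z' Ev']|_]; first by case/negP: ys; rewrite Ey Ev' nth_s.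
  case: ifP => [inn_z' [Ek]|_]; first by rewrite Ek Ey eqxx in k1y.
  by case: eqP.
have C_size z K : C z = inr K -> #|{: spider_vert t}| <= #|K|.
  rewrite /C /ray; do ![case: ifP => _ //]; by case=> <-.
have C_host z b : ~~ outward i j a z -> in_cell b (C z) -> b \in h (k (+) odd (depth z.2)).
  move=> /negPf out_z; rewrite /C out_z; case: ifP => [/andP[_ st] /eqP -> |_].
    by have := spider_step_depth st; rewrite /= => -[<-].
  by case: eqP => [-> /eqP ->|].
have C_step i0 v v' : spider_step v v' -> compatible e (C (i0, v)) (C (i0, v')).
  move=> st; have Ed := spider_step_depth st.
  have [out_v|nout_v] := boolP (outward i j a (i0, v)).
    rewrite /C out_v (outward_step st out_v) /=.
    have [/= lt_v _] := outward_depth out_v; rewrite Ed subSS.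
    have -> : depth v - a = (depth v - a.+1).+1 by move: lt_v; clear; lia.
    exact: ray_compatible.
  have [out_v'|nout_v'] := boolP (outward i j a (i0, v')).
    have [Ei Ev'] := outward_root st nout_v out_v'; subst i0 v'.
    rewrite -/u Cu /C (negPf nout_v) /inner /= eqxx st => b d /eqP -> /eqP -> _.
    by rewrite e_sym.
  move=> b d /(C_host _ _ nout_v) b_h /(C_host _ _ nout_v') d_h.
  by apply: (h_host _ _ _ b_h); move: d_h; rewrite /= Ed /= addbN.
have [g [g_emb g_in]] := spider_embedding_of_cells e_sym C_inj C_size C_step.
exists g; split=> //.
by have := g_in u; have := g_in w; rewrite Cu Cw => /eqP -> /eqP ->.
Qed.

(* Sending u to [b0] and its inner neighbour to [z0], which behaves like a vertex
   of [h true] that is adjacent to [b0], puts u and w on the same side. *)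
Lemma switch_embedding t (T : finType) (e : rel T) (h : bool -> {set T}) z0 b0
    (i : 'I_t) (j : 'I_3) (a : 'I_t) (w : spider_vert t) :
  symmetric e -> host e h -> (forall b, #|{: spider_vert t}| <= #|h b|) ->
  (forall x y, x \in h true -> y \in h true -> ~~ e x y) ->
  (forall y, y \in h false -> e z0 y) -> b0 \in h true -> e z0 b0 -> z0 != b0 ->
  odd (depth w.2) = odd a ->
  ~~ spider_adj (i, Some (j, a)) w -> ~~ outward i j a w ->
  exists g, embedding e (@spider_adj t) g /\ ~~ e (g (i, Some (j, a))) (g w).
Proof.
move=> e_sym h_host h_big h_indep z0_full b0_h ez0b0 z0b0 w_par nadj nout.
set u := (i, Some (j, a)).
pose inner z := (z.1 == i) && spider_step z.2 u.2.
pose C z := if outward i j a z then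
    (if z == u then inl b0 else inr (h (odd (depth z.2) (+) odd a)))
  else if inner z then inl z0 else inr (h (~~ (odd (depth z.2) (+) odd a))).
have inner_uniq z z' : inner z -> inner z' -> z = z'.
  case: z z' => [i1 v] [i2 v'] /andP[/eqP /= -> st] /andP[/eqP /= -> st'].
  by congr (_, _); apply: spider_step_pred_uniq st st'.
have out_u : outward i j a u by rewrite /outward /= !eqxx leqnn.
have Cu : C u = inl b0 by rewrite /C out_u eqxx.
have Cw : C w = inr (h true).
  rewrite /C (negPf nout); case: ifP => [/andP[/eqP Ew st]|_]; last by rewrite w_par addbb.
  by case/negP: nadj; rewrite /spider_adj /= Ew eqxx st orbT.
have C_inj z z' v : C z = inl v -> C z' = inl v -> z = z'.
  rewrite /C; case: ifP => [_|_].
    case: eqP => // -> [Ev]; case: ifP => [_|_]; first by case: eqP => [->|].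
    by case: ifP => // _ [Ev']; rewrite Ev Ev' eqxx in z0b0.
  case: ifP => // inn_z [Ev]; case: ifP => [_|_].
    by case: eqP => // _ [Ev']; rewrite Ev Ev' eqxx in z0b0.
  by case: ifP => // inn_z' _; apply: inner_uniq.
have C_size z K : C z = inr K -> #|{: spider_vert t}| <= #|K|.
  by rewrite /C; do ![case: ifP => _ //]; case=> <-.
have C_out z b : outward i j a z -> in_cell b (C z) -> b \in h (odd (depth z.2) (+) odd a).
  by move=> out_z; rewrite /C out_z; case: eqP => // -> /eqP ->; rewrite /= addNb addbb.
have C_step i0 v v' : spider_step v v' -> compatible e (C (i0, v)) (C (i0, v')).
  move=> st; have Ed := spider_step_depth st.
  have [out_v|nout_v] := boolP (outward i j a (i0, v)).
    move=> b d /(C_out _ _ out_v) b_h /(C_out _ _ (outward_step st out_v)) d_h.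
    by apply: (h_host _ _ _ b_h); move: d_h; rewrite /= Ed /= addNb.
  have [out_v'|nout_v'] := boolP (outward i j a (i0, v')).
    have [Ei Ev'] := outward_root st nout_v out_v'; subst i0 v'.
    by rewrite -/u Cu /C (negPf nout_v) /inner /= eqxx st => b d /eqP -> /eqP -> _.
  move=> b d; rewrite /C (negPf nout_v) (negPf nout_v').
  case: ifP => [/andP[_ /spider_step_depth /= [Ea]] /eqP ->|_].
    case: ifP => [/andP[_ /spider_step_depth /= [Ea']]|_]; first by move: Ed; rewrite -Ea -Ea'; clear; lia.
    by rewrite /= Ed /= -Ea addNb addbb => d_h _; apply: z0_full.
  case: ifP => [/andP[_ /spider_step_depth /= [Ea']] b_h /eqP ->|_ b_h d_h].
    rewrite e_sym => _; apply: z0_full; move: b_h.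
    by rewrite /= Ea' Ed /= addbN addbb.
  by apply: (h_host _ _ _ b_h); move: d_h; rewrite /= Ed /= addNb.
have [g [g_emb g_in]] := spider_embedding_of_cells e_sym C_inj C_size C_step.
exists g; split=> //.
have := g_in u; have := g_in w; rewrite Cu Cw => w_h /eqP ->.
by apply: h_indep.
Qed.

(** Each copy is coloured by the parity of the depth, with the colours flipped copy by copy so that
    [u] and [w] both land in the independent side [h true]. *)
Lemma flat_embedding t (T : finType) (e : rel T) (h : bool -> {set T}) (u w : spider_vert t) :
  symmetric e -> host e h -> (forall b, #|{: spider_vert t}| <= #|h b|) ->
  (forall x y, x \in h true -> y \in h true -> ~~ e x y) ->
  (u.1 != w.1) || (odd (depth u.2) == odd (depth w.2)) ->
  exists g, embedding e (@spider_adj t) g /\ ~~ e (g u) (g w).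
Proof.
move=> e_sym h_host h_big h_indep uw.
pose shift (i : 'I_t) := if i == u.1 then ~~ odd (depth u.2) else ~~ odd (depth w.2).
pose C (z : spider_vert t) : T + {set T} := inr (h (shift z.1 (+) odd (depth z.2))).
have [||i v v' st|g [g_emb g_in]] := @spider_embedding_of_cells t T e C e_sym.
- by [].
- by move=> z K [<-].
- by rewrite /C /= (spider_step_depth st) /= addbN; apply: h_host.
exists g; split=> //; have := g_in u; have := g_in w.
rewrite /C /shift /= eqxx addNb addbb /= => w_h u_h; apply: h_indep => //.
move: uw w_h; case: ifP => [/eqP ->|_ _]; last by rewrite addNb addbb.
by rewrite eqxx /= => /eqP ->; rewrite addNb addbb.
Qed.

(** The centre of copy [i] goes to [x]; its legs run along paths that share only [x] into the clique
    and continue there. Everything else lies in the clique, with the centre of copy [i'] at the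
    non-neighbour [y] of [x]. *)
Lemma centres_embedding t (T : finType) (e : rel T) (K : {set T}) x y (S : 'I_3 -> seq T)
    (i i' : 'I_t) :
  symmetric e -> is_clique e K -> #|{: spider_vert t}| <= #|K| ->
  (forall j, path e x (S j)) -> (forall j, last x (S j) \in K) ->
  (forall j, uniq (x :: S j)) ->
  (forall j j' v, v \in S j -> v \in S j' -> j = j') ->
  (forall j, y \notin x :: S j) -> y \in K -> ~~ e x y -> i != i' ->
  exists g, embedding e (@spider_adj t) g /\ ~~ e (g (i, None)) (g (i', None)).
Proof.
move=> e_sym K_clique K_big S_path S_last S_uniq S_disj yS yK nexy ii'.
pose h (b : bool) := K.
have h_host : host e h by move=> c a b aK bK; apply: K_clique.
(* The leg assigned to a centre is arbitrary: at depth 0 every ray gives [x]. *)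
pose leg (v : option ('I_3 * 'I_t)) : 'I_3 := if v is Some (j, _) then j else ord0.
pose C (z : spider_vert t) := if z.1 == i then ray h true x (S (leg z.2)) (depth z.2)
  else if z == (i', None) then inl y else inr K.
have Cu : C (i, None) = inl x by rewrite /C /= eqxx /ray leq0n.
have Cw : C (i', None) = inl y by rewrite /C /= eq_sym (negPf ii') eqxx.
have C_inj z z' v : C z = inl v -> C z' = inl v -> z = z'.
  rewrite /C; case: eqP => [Ez /ray_inl[le_z Ev]|_].
    case: eqP => [Ez' /ray_inl[le_z' Ev']|_].
      case: z z' Ez Ez' le_z le_z' Ev Ev' => [i1 w] [i2 w'] /= -> ->.
      have nthS j n : n < size (S j) -> nth x (x :: S j) n.+1 \in S j by apply: mem_nth.
      have xS j : x \notin S j by case/andP: (S_uniq j).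
      case: w w' => [[j b]|] [[j' b']|] //=.
      + move=> lt_b lt_b' -> E.
        have jj' : j = j'.
          by apply: S_disj (nthS _ _ lt_b) _; rewrite /= E; apply: (nthS _ _ lt_b').
        rewrite -jj' in E lt_b' *; move/eqP: E; rewrite nth_uniq //.
          by move=> /eqP/ord_inj ->.
        by case/andP: (S_uniq j).
      + by move=> lt_b _ -> E; case/negP: (xS j); rewrite -{1}E; apply: (nthS _ _ lt_b).
      + by move=> _ lt_b -> E; case/negP: (xS j'); rewrite {1}E; apply: (nthS _ _ lt_b).
    case: eqP => // _ [Ey]; case/negP: (yS (leg z.2)); rewrite Ey Ev.
    exact: mem_nth.
  case: eqP => // -> [Ey]; case: eqP => [Ez' /ray_inl[le_z' Ev']|_]; last by case: eqP.
  by case/negP: (yS (leg z'.2)); rewrite Ey Ev' mem_nth.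
have C_size z L : C z = inr L -> #|{: spider_vert t}| <= #|L|.
  by rewrite /C /ray; do ![case: ifP => _ //]; case=> <-.
have C_step i0 v v' : spider_step v v' -> compatible e (C (i0, v)) (C (i0, v')).
  move=> st; rewrite /C /=; case: eqP => [_|_].
    rewrite (spider_step_depth st).
    have -> : ray h true x (S (leg v)) (depth v) = ray h true x (S (leg v')) (depth v).
      by case: v v' st => [[j b]|] [[j' b']|] //= /andP[/eqP ->].
    exact: ray_compatible.
  have C_K w b : in_cell b (if (i0, w) == (i', None) then inl y else inr K) -> b \in K.
    by case: eqP => [_ /eqP ->|].
  by move=> b d /C_K bK /C_K dK; apply: K_clique.
have [g [g_emb g_in]] := spider_embedding_of_cells e_sym C_inj C_size C_step.
exists g; split=> //.
by have := g_in (i, None); have := g_in (i', None); rewrite Cu Cw => /eqP -> /eqP ->.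
Qed.

(** * Components and the paths through them *)

Section Components.
Variables (T : finType) (e : rel T).
Hypothesis e_sym : symmetric e.

Definition restrict (D : {set T}) : rel T := [rel a b | [&& e a b, a \in D & b \in D]].

Definition connected_set (D : {set T}) : Prop :=
  {in D &, forall x y, connect (restrict D) x y}.

Definition component (O : {set T}) (d : T) : {set T} := [set y | connect (restrict O) d y].

Lemma restrict_sym D : symmetric (restrict D).
Proof. by move=> x y; rewrite /restrict /= e_sym [(x \in D) && _]andbC. Qed.

Lemma mem_component O d : d \in component O d.
Proof. by rewrite inE. Qed.

Lemma component_sub (O : {set T}) d : d \in O -> component O d \subset O.
Proof.
move=> dO; apply/subsetP => y; rewrite inE => /connectP[p].
elim/last_ind: p => [|p z _]; first by move=> _ ->.
by rewrite rcons_path last_rcons => /andP[_ /and3P[]] ? ? ? ->.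
Qed.

Lemma component_closed (O : {set T}) d x y :
  d \in O -> x \in component O d -> e x y -> y \in O -> y \in component O d.
Proof.
move=> dO xC exy yO; have xO := subsetP (component_sub dO) x xC.
move: xC; rewrite !inE => /connect_trans; apply; apply: connect1.
by rewrite /restrict /= exy xO yO.
Qed.

Lemma component_connected (O : {set T}) d : d \in O -> connected_set (component O d).
Proof.
move=> dO; set D := component O d.
have from_d y : y \in D -> connect (restrict D) d y.
  rewrite inE => /connectP[p p_path ->].
  elim/last_ind: p p_path => [|p z IHp]; first by rewrite connect0.
  rewrite rcons_path last_rcons => /andP[p_path /and3P[exy xO zO]].
  apply: connect_trans (IHp p_path) _; apply: connect1.
  have xD : last d p \in D by rewrite inE; apply/connectP; exists p.
  by rewrite /restrict /= exy xD (component_closed dO xD exy).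
move=> x y xD yD; apply: connect_trans (from_d y yD).
by rewrite (sym_connect_sym (restrict_sym D)); apply: from_d.
Qed.

Lemma connected_set_path (D : {set T}) x y :
  connected_set D -> x \in D -> y \in D ->
  exists p, [/\ path e x p, last x p = y, uniq (x :: p) & {subset x :: p <= D}].
Proof.
move=> D_conn xD yD; case/connectP: (D_conn x y xD yD) => p0 p0_path ->.
case/shortenP: p0_path => p p_path p_uniq _; exists p; split=> //.
  by apply: sub_path p_path => a b /and3P[].
move=> z; rewrite inE => /predU1P[-> //|z_p].
elim: p x {xD p_uniq} p_path z_p => //= a p IHp x /andP[/and3P[_ _ aD]] p_path.
by rewrite inE => /predU1P[->|/(IHp a p_path)].
Qed.

Lemma cutset_of_closed (D B : {set T}) d v :
  (forall x y, x \in D -> e x y -> y \in D :|: B) ->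
  d \in D -> d \notin B -> v \notin D -> v \notin B -> disconnected_minus e B.
Proof.
move=> D_closed dD dB vD vB; exists d, v; split=> //.
apply: contra vD => /connectP[p p_path ->].
elim: p d dD p_path {dB} => //= a p IHp d dD /andP[/and3P[eda _ aB] p_path].
by apply: IHp p_path; have := D_closed d a dD eda; rewrite inE (negPf aB) orbF.
Qed.

(** If some vertex of [D] has two neighbours in [A], a single edge serves as the path. Otherwise
    take a path in [D] from [d1] to [d2] followed by [a2]; any third vertex of [A] is a
    non-neighbour of [d1], whose only neighbour in [A] is [a1]. *)
Lemma attachment (D A : {set T}) a1 a2 d1 d2 :
  connected_set D -> [disjoint D & A] -> a1 \in A -> a2 \in A -> a1 != a2 ->
  d1 \in D -> d2 \in D -> e d1 a1 -> e d2 a2 ->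
  (forall x, x \in D -> exists2 y, y \in A & ~~ e x y) -> 3 <= #|A| ->
  exists x s k1 y, [/\ path e x s, last x s \in A, k1 \in A & y \in A]
    /\ [/\ e x k1, ~~ e x y & uniq [:: k1, y, x & s]].
Proof.
move=> D_conn DA a1A a2A a12 d1D d2D e1 e2 nonnbr A_big.
have notA x : x \in D -> x \notin A by move=> xD; rewrite (disjointFr DA xD).
have neqA x a : x \in D -> a \in A -> a == x = false.
  by move=> /notA xA aA; apply/eqP => E; rewrite -E aA in xA.
have [/existsP[x /existsP[k1 /existsP[k2 /and5P[]]]]|none] :=
  boolP [exists x, exists k1, exists k2,
    [&& x \in D, k1 \in A, k2 \in A, k1 != k2 & e x k1 && e x k2]].
  move=> xD k1A k2A k12 /andP[exk1 exk2]; have [y yA nexy] := nonnbr x xD.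
  exists x, [:: k2], k1, y; do 2!split=> //=; first by rewrite exk2.
  have yk1 : k1 == y = false by apply/eqP => E; rewrite -E exk1 in nexy.
  have yk2 : y == k2 = false by apply/eqP => E; rewrite E exk2 in nexy.
  by rewrite !inE yk1 yk2 (negPf k12) !(neqA x) // eq_sym neqA.
have [y yA yB] : exists2 y, y \in A & y \notin [set a1; a2].
  apply/subsetPn/negP => /subset_leq_card; rewrite cards2 a12; move: A_big; clear; lia.
have [p [p_path p_last p_uniq pD]] := connected_set_path D_conn d1D d2D.
have neqp a : a \in A -> a \notin d1 :: p by move=> aA; apply/negP => /pD /notA; rewrite aA.
exists d1, (rcons p a2), a1, y; split; first by split; rewrite // ?rcons_path ?last_rcons ?p_last ?p_path.
split=> //.
  apply/negP => e1y; case/negP: none.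
  apply/existsP; exists d1; apply/existsP; exists a1; apply/existsP; exists y.
  by rewrite d1D a1A yA e1 e1y !andbT; apply: contra yB => /eqP <-; rewrite !inE eqxx.
move: yB; rewrite !inE negb_or => /andP[ya1 ya2].
have := neqp _ a1A; have := neqp _ a2A; have := neqp _ yA.
rewrite !inE !negb_or => /andP[yd1 yp] /andP[a2d1 a2p] /andP[a1d1 a1p].
move: p_uniq => /= /andP[d1p up]; rewrite /= !inE !mem_rcons !inE !negb_or rcons_uniq.
by rewrite ya2 yd1 yp a1d1 a1p a2p d1p up a12 eq_sym ya1 eq_sym a2d1.
Qed.

Lemma rev_path_to k x (P1 P2 : seq T) :
  path e k (P1 ++ x :: P2) -> path e x (rcons (rev P1) k).
Proof.
rewrite -cat_rcons cat_path => /andP[+ _].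
rewrite -[path e k _]/(sorted e (k :: rcons P1 x)) -rev_sorted rev_cons rev_rcons rcons_cons.
rewrite -[sorted _ _]/(path _ x _); apply: sub_path => a b.
by rewrite e_sym.
Qed.

(** A path in [D] joins neighbours of the first two ends; a path from a neighbour of the third end
    is cut at the first vertex [x] where it meets the former. The three segments leaving [x] are the
    paths wanted. *)
Lemma branching (D K : {set T}) (k : 'I_3 -> T) :
  connected_set D -> [disjoint D & K] -> injective k -> (forall j, k j \in K) ->
  (forall j, exists2 d, d \in D & e d (k j)) ->
  exists x (S : 'I_3 -> seq T), x \in D /\
    [/\ forall j, path e x (S j), forall j, last x (S j) = k j,
        forall j, uniq (x :: S j), forall j v, v \in S j -> v = k j \/ v \in D &
        forall j j' v, v \in S j -> v \in S j' -> j = j'].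
Proof.
move=> D_conn DK k_inj kK nbr.
have notD j : k j \notin D by rewrite (disjointFl DK (kK j)).
have [d0 d0D e0] := nbr ord0.
have [d1 d1D e1] := nbr (inord 1).
have [d2 d2D e2] := nbr (inord 2).
have [p [p_path p_last p_uniq pD]] := connected_set_path D_conn d0D d1D.
have [q [q_path q_last q_uniq qD]] := connected_set_path D_conn d2D d0D.
have [Q1 [x [Q2 [EQ xP Q1P]]]] : exists Q1 x Q2,
    [/\ d2 :: q = Q1 ++ x :: Q2, x \in d0 :: p & ~~ has (mem (d0 :: p)) Q1].
  have : has (mem (d0 :: p)) (d2 :: q).
    by apply/hasP; exists d0; [rewrite -q_last mem_last | rewrite /= mem_head].
  case/split_find => x Q1 Q2 xP Q1P; exists Q1, x, Q2; split=> //.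
  by rewrite cat_rcons.
have [P1 [P2 EP]] : exists P1 P2, d0 :: p = P1 ++ x :: P2.
  by case/splitPr: xP => P1 P2; exists P1, P2.
rewrite EP in p_uniq pD Q1P; rewrite EQ in q_uniq qD.
have path0 : path e x (rcons (rev P1) (k ord0)).
  by apply: (@rev_path_to _ x P1 P2); rewrite -EP /= e_sym e0.
have path2 : path e x (rcons (rev Q1) (k (inord 2))).
  by apply: (@rev_path_to _ x Q1 Q2); rewrite -EQ /= e_sym e2.
have path1 : path e x (rcons P2 (k (inord 1))).
  have : path e (k ord0) (P1 ++ x :: P2) by rewrite -EP /= e_sym e0.
  rewrite cat_path rcons_path /= => /and3P[_ _ ->].
  have -> : last x P2 = d1 by rewrite -p_last -[last d0 p]/(last d0 (d0 :: p)) EP last_cat.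
  by rewrite e1.
pose S (j : 'I_3) : seq T := if j == 0 :> nat then rcons (rev P1) (k j) else
   if j == 1 :> nat then rcons P2 (k j) else rcons (rev Q1) (k j).
pose R (j : 'I_3) : seq T := if j == 0 :> nat then P1 else if j == 1 :> nat then P2 else Q1.
have S_mem j v : (v \in S j) = (v == k j) || (v \in R j).
  by rewrite /S /R; do 2?case: ifP => _; rewrite mem_rcons inE ?mem_rev.
have RD j v : v \in R j -> v \in D.
  rewrite /R; do 2?case: ifP => _; move=> vR.
  - by apply: pD; rewrite mem_cat vR.
  - by apply: pD; rewrite mem_cat inE vR !orbT.
  - by apply: qD; rewrite mem_cat vR.
have xD : x \in D by apply: pD; rewrite mem_cat mem_head orbT.
have disjR (j j' : 'I_3) v : v \in R j -> v \in R j' -> j < j' -> False.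
  move: p_uniq; rewrite cat_uniq /= => /and4P[_ /norP[_ /hasPn disjP] _ _].
  have disjQ : v \in Q1 -> v \notin P1 ++ x :: P2.
    by move=> vQ; apply/negP => vP; case/hasP: Q1P; exists v.
  have := ltn_ord j'; rewrite /R; case: (j : nat) => [|[|j1]]; case: (j' : nat) => [|[|j2]] //=.
  - by move=> _ vP1 /disjP; rewrite vP1.
  - by move=> _ vP1 /disjQ; rewrite mem_cat vP1.
  - by move=> _ vP2 /disjQ; rewrite mem_cat inE vP2 !orbT.
  - by rewrite !ltnS leqn0 => /eqP ->.
have xR j : x \notin R j.
  move: p_uniq q_uniq; rewrite !cat_uniq /= !negb_or.
  move=> /and4P[_ /andP[xP1 _] xP2 _] /and4P[_ /andP[xQ1 _] _ _].
  by rewrite /R; do 2?case: ifP.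
exists x, S; split=> //; split.
- move=> j; rewrite /S; case: j => [[|[|[|//]]] lt_j] /=.
  + by rewrite (_ : Ordinal _ = ord0) //; apply: ord_inj.
  + by rewrite (_ : Ordinal _ = inord 1) //; apply: ord_inj; rewrite inordK.
  + by rewrite (_ : Ordinal _ = inord 2) //; apply: ord_inj; rewrite inordK.
- by move=> j; rewrite /S; do 2?case: ifP => _; rewrite last_rcons.
- move=> j; rewrite cons_uniq S_mem negb_or xR andbT.
  have neq_k : x != k j by apply/eqP => E; have := notD j; rewrite -E xD.
  have kR : k j \notin R j by apply/negP => /RD; rewrite (negPf (notD j)).
  rewrite neq_k /=; move: kR p_uniq q_uniq; rewrite !cat_uniq /= /R /S.
  move=> kR /and4P[uP1 _ _ uP2] /and4P[uQ1 _ _ _].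
  by move: kR; do 2?case: ifP => _; rewrite rcons_uniq ?mem_rev ?rev_uniq => ->.
- by move=> j v; rewrite S_mem => /orP[/eqP ->|/RD]; [left|right].
- move=> j j' v; rewrite !S_mem => /orP[/eqP ->|vR] /orP[/eqP E|vR'].
  + exact: k_inj.
  + by have := RD _ _ vR'; rewrite (negPf (notD j)).
  + by have := RD _ _ vR; rewrite E (negPf (notD j')).
  + apply: ord_inj; case: (ltngtP j j') => // lt_j; exfalso.
      exact: disjR vR vR' lt_j.
    exact: disjR vR' vR lt_j.
Qed.
End Components.

(** * Large cliques and large bicliques *)

Definition separable t (T : finType) (e : rel T) (u w : spider_vert t) : Prop :=
  exists g, embedding e (@spider_adj t) g /\ ~~ e (g u) (g w).

Lemma separable_sym t (T : finType) (e : rel T) (u w : spider_vert t) :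
  symmetric e -> separable e u w -> separable e w u.
Proof. by move=> e_sym [g [g_emb g_sep]]; exists g; rewrite e_sym. Qed.

(** Two distinct vertices cannot each lie outward from the other, and a centre lies outward from
    nothing. So unless both are centres, one of them is a leg vertex from which the other is not
    outward. *)
Lemma nonadjacent_pair_cases t (Q : spider_vert t -> spider_vert t -> Prop) :
  (forall u w, Q u w -> Q w u) ->
  (forall i i', i != i' -> Q (i, None) (i', None)) ->
  (forall i j a w, ~~ spider_adj (i, Some (j, a)) w -> ~~ outward i j a w ->
     Q (i, Some (j, a)) w) ->
  forall u w, u != w -> ~~ spider_adj u w -> Q u w.
Proof.
move=> Q_sym Q_centres Q_leg [i v] [i' v'] neq nadj.
have leg_or (j : 'I_3) (a : 'I_t) : v = Some (j, a) ->
    outward i j a (i', v') \/ Q (i, v) (i', v').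
  move=> Ev; rewrite Ev in nadj *; case: (boolP (outward _ _ _ _)); first by left.
  by right; apply: Q_leg.
have leg_or' (j : 'I_3) (a : 'I_t) : v' = Some (j, a) ->
    outward i' j a (i, v) \/ Q (i, v) (i', v').
  move=> Ev'; rewrite Ev' in nadj *; case: (boolP (outward _ _ _ _)); first by left.
  by right; apply/Q_sym/Q_leg; rewrite // spider_adj_sym.
move: neq nadj leg_or leg_or'; case: v v' => [[j a]|] [[j' a']|] neq nadj leg_or leg_or'.
- case: (leg_or j a erefl) => // out1; case: (leg_or' j' a' erefl) => // out2.
  move: out1 out2 neq; rewrite /outward /= => /and3P[/eqP -> /eqP -> le1] /and3P[_ _ le2].
  by rewrite (_ : a = a') ?eqxx //; apply: ord_inj; apply/eqP; rewrite eqn_leq le1.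
- by case: (leg_or j a erefl).
- by case: (leg_or' j' a' erefl).
- by apply: Q_centres; apply: contra neq => /eqP ->.
Qed.

Lemma distinct_members (T : finType) (n : nat) (B : {set T}) :
  n <= #|B| -> exists2 k : 'I_n -> T, injective k & forall j, k j \in B.
Proof.
move=> B_big; exists (fun j => enum_val (widen_ord B_big j)); last by move=> j; apply: enum_valP.
by move=> j j' /enum_val_inj /(congr1 val) /= /ord_inj.
Qed.

Lemma ex_notin_small (T : finType) (A B : {set T}) :
  #|B| < #|A| -> exists2 y, y \in A & y \notin B.
Proof.
by move=> lt_BA; apply/subsetPn/negP => /subset_leq_card; rewrite leqNgt lt_BA.
Qed.

Section Dense.
Variables (t : nat) (T : finType) (e : rel T).
Hypotheses (e_sym : symmetric e) (e_irr : irreflexive e).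
Hypothesis no_cutset : forall U : {set T}, #|U| <= 2 -> ~ clique_cutset e U.

Let order_spider := #|{: spider_vert t}|.

Definition neighbours (D X : {set T}) : {set T} := [set b in X | [exists x in D, e x b]].

(** Otherwise these at most two vertices would form a clique cutset that separates [d] from another
    vertex of [X]. *)
Lemma neighbours_not_cutset (X : {set T}) d :
  d \notin X -> 2 < #|X| -> is_clique e (neighbours (component e (~: X) d) X) ->
  2 < #|neighbours (component e (~: X) d) X|.
Proof.
move=> dX X_big B_clique; set D := component _ _ _ in B_clique *.
set B := neighbours D X in B_clique *; rewrite ltnNge; apply/negP => B_small.
apply: (no_cutset B_small); split=> //.
have dO : d \in ~: X by rewrite inE.
have D_sub : {subset D <= ~: X} := subsetP (component_sub e dO).
have [v vX vB] : exists2 v, v \in X & v \notin B.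
  by apply: ex_notin_small; apply: leq_ltn_trans X_big.
apply: (@cutset_of_closed _ e D B d v) => //.
- move=> x y xD exy; rewrite inE; case: (boolP (y \in X)) => yX.
    by rewrite [y \in B]inE yX /=; apply/orP; right; apply/existsP; exists x; rewrite xD.
  by rewrite (component_closed dO xD exy) // inE.
- exact: mem_component.
- by rewrite inE (negPf dX).
- by apply/negP => /D_sub; rewrite inE vX.
Qed.

(** A component outside a maximum clique [K] has three neighbours in [K]. Two centres are separated
    by a branching vertex with three paths to [K], any other pair by a path from [attachment]. *)
Lemma clique_separable (K0 : {set T}) (u w : spider_vert t) :
  ~ complete_graph e -> is_clique e K0 -> order_spider <= #|K0| -> 6 <= #|K0| ->
  u != w -> ~~ spider_adj u w -> separable e u w.
Proof.
move=> ncomplete K0_clique; rewrite /order_spider => K0_big K0_6.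
pose isclique (K : {set T}) := [forall x in K, forall y in K, (x != y) ==> e x y].
have iscliqueP (K : {set T}) : reflect (is_clique e K) (isclique K).
  apply: (iffP forall_inP) => [h x y xK yK neq|h x xK].
    by have /forall_inP/(_ y yK) := h x xK; rewrite neq.
  by apply/forall_inP => y yK; apply/implyP; apply: h.
have K0_is : isclique K0 by apply/iscliqueP.
case: (@arg_maxnP _ K0 isclique (fun K => #|K|) K0_is) => K /iscliqueP K_clique K_max.
have le_K : #|K0| <= #|K| := K_max K0 K0_is.
have K_big := leq_trans K0_big le_K; have K_6 := leq_trans K0_6 le_K.
have nonnbr x : x \notin K -> exists2 y, y \in K & ~~ e x y.
  move=> xK; apply/exists_inP; rewrite -[[exists _ in _, _]]negbK negb_exists_in.
  apply/negP => /forall_inP full; have /K_max : isclique (x |: K).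
    apply/iscliqueP => a b; rewrite !inE => /predU1P[->|aK] /predU1P[->|bK].
    - by rewrite eqxx.
    - by move=> _; rewrite -[e x b]negbK full.
    - by move=> _; rewrite e_sym -[e x a]negbK full.
    - exact: K_clique.
  by rewrite cardsU1 xK /= ltnn.
have [d dK] : exists d, d \notin K.
  apply/existsP; rewrite -[[exists _, _]]negbK negb_exists; apply/negP => /forallP full.
  by apply: ncomplete => x y; apply: K_clique; rewrite -[_ \in _]negbK.
pose D := component e (~: K) d; pose B := neighbours D K.
have dO : d \in ~: K by rewrite inE.
have D_sub x : x \in D -> x \notin K by move/(subsetP (component_sub e dO)); rewrite inE.
have D_conn : connected_set e D := component_connected e_sym dO.
have DK : [disjoint D & K].
  by rewrite disjoints_subset; apply: component_sub.
have BK b : b \in B -> b \in K by rewrite inE => /andP[].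
have B_big : 2 < #|B|.
  apply: neighbours_not_cutset => //; first by apply: leq_trans K_6.
  by move=> x y /BK xK /BK yK; apply: K_clique.
have [k k_inj kB] := distinct_members B_big.
have kK j : k j \in K := BK _ (kB j).
have knbr j : exists2 x, x \in D & e x (k j).
  by have := kB j; rewrite inE => /andP[_ /exists_inP[x xD exk]]; exists x.
move: u w; apply: nonadjacent_pair_cases.
- by move=> u w; apply: separable_sym.
- move=> i i' ii'.
  pose nb x := [set y in K | e x y].
  have [/existsP[x /andP[xK x_big]]|none] := boolP [exists x, (x \notin K) && (2 < #|nb x|)].
    have [k' k'_inj k'nb] := distinct_members x_big.
    have k'K j : k' j \in K by have := k'nb j; rewrite inE => /andP[].
    have exk' j : e x (k' j) by have := k'nb j; rewrite inE => /andP[].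
    have [y yK nexy] := nonnbr x xK.
    apply: (@centres_embedding t T e K x y (fun j => [:: k' j])) => //.
    + by move=> j; rewrite /= exk'.
    + by move=> j /=; rewrite inE andbT; apply/eqP => E; rewrite E k'K in xK.
    + by move=> j j' v; rewrite !inE => /eqP -> /eqP /k'_inj.
    + move=> j; rewrite !inE negb_or; apply/andP; split.
        by apply/eqP => E; rewrite -E yK in xK.
      by apply/eqP => E; rewrite E exk' in nexy.
  have [x [S [xD [S_path S_last S_uniq S_mem S_disj]]]] :=
    branching e_sym D_conn DK k_inj kK knbr.
  have xK := D_sub x xD.
  (* Six vertices suffice: at most two are neighbours of [x], and three are ends of the paths. *)
  have [y yK] : exists2 y, y \in K & y \notin nb x :|: [set k j | j : 'I_3].
    apply: ex_notin_small; apply: leq_trans K_6; rewrite ltnS (leq_trans (leq_card_setU _ _)) //.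
    have nb_small : #|nb x| <= 2.
      by rewrite leqNgt; apply: contra none => x_big; apply/existsP; exists x; rewrite xK.
    apply: (leq_add nb_small).
    by apply: leq_trans (leq_imset_card _ _) _; rewrite card_ord.
  rewrite inE negb_or inE yK /= => /andP[nexy yk].
  apply: (@centres_embedding t T e K x y S) => //.
  + by move=> j; rewrite S_last.
  + move=> j; rewrite inE negb_or; apply/andP; split.
      by apply/eqP => E; rewrite -E yK in xK.
    apply/negP => /S_mem[E|/D_sub]; last by rewrite yK.
    by case/negP: yk; apply/imsetP; exists j.
- move=> i j a w nadj nout.
  have k01 : k ord0 != k (inord 1).
    by apply/eqP => /k_inj /(congr1 val); rewrite /= inordK.
  have [d1 d1D e1] := knbr ord0; have [d2 d2D e2] := knbr (inord 1).
  have [||x [s [k1 [y [[s_path s_last k1K yK] [exk1 nexy s_uniq]]]]]] :=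
    attachment D_conn DK (kK _) (kK _) k01 d1D d2D e1 e2.
  + by move=> x /D_sub /nonnbr.
  + by apply: leq_trans K_6.
  apply: (@leg_embedding t T e (fun=> K) true true x s k1 y) => //.
Qed.

Definition induced_biclique (A B : {set T}) : bool :=
  [&& [forall x in A, forall y in A, ~~ e x y], [forall x in B, forall y in B, ~~ e x y] &
      [forall x in A, forall y in B, e x y]].

Lemma induced_bicliqueP (A B : {set T}) :
  reflect [/\ {in A &, forall x y, ~~ e x y}, {in B &, forall x y, ~~ e x y} &
              {in A & B, forall x y, e x y}]
          (induced_biclique A B).
Proof.
apply: (iffP and3P) => -[hA hB hAB]; split.
- by move=> x y xX yX; have /forall_inP/(_ x xX)/forall_inP/(_ y yX) := hA.
- by move=> x y xX yX; have /forall_inP/(_ x xX)/forall_inP/(_ y yX) := hB.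
- by move=> x y xX yX; have /forall_inP/(_ x xX)/forall_inP/(_ y yX) := hAB.
- by apply/forall_inP => x xA; apply/forall_inP => y; apply: hA.
- by apply/forall_inP => x xA; apply/forall_inP => y; apply: hB.
- by apply/forall_inP => x xA; apply/forall_inP => y; apply: hAB.
Qed.

Lemma biclique_separable (A0 B0 : {set T}) (u w : spider_vert t) :
  (forall x y : T, ~ false_twins e x y) ->
  induced_biclique A0 B0 -> order_spider <= #|A0| -> order_spider <= #|B0| ->
  3 <= #|A0| -> 3 <= #|B0| ->
  u != w -> ~~ spider_adj u w -> separable e u w.
Proof.
move=> no_twins biclique0; rewrite /order_spider => A0_big B0_big A0_3 B0_3.
pose P (p : {set T} * {set T}) :=
  [&& induced_biclique p.1 p.2, A0 \subset p.1 & B0 \subset p.2].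
have P0 : P (A0, B0) by rewrite /P /= biclique0 !subxx.
case: (@arg_maxnP _ _ P (fun p => #|p.1| + #|p.2|) P0) => -[A B] /= /and3P[].
move=> /= /induced_bicliqueP[A_indep B_indep AB] sA sB max.
have leA := subset_leq_card sA; have leB := subset_leq_card sB.
pose h (c : bool) := if c then B else A.
have h_indep c : {in h c &, forall x y, ~~ e x y} by case: c.
have h_join c : {in h c & h (~~ c), forall x y, e x y}.
  by case: c => x y xh yh; [rewrite e_sym|]; apply: AB.
have h_host : host e h by move=> c x y xh yh _; apply: (h_join c).
have h_big c : #|{: spider_vert t}| <= #|h c|.
  by case: c; [apply: leq_trans leB | apply: leq_trans leA].
have h_3 c : 3 <= #|h c| by case: c; [apply: leq_trans leB | apply: leq_trans leA].
have h_sub c x : x \in h c -> x \in A :|: B by rewrite inE; case: c => /= ->; rewrite ?orbT.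
have h_ex x : x \in A :|: B -> exists c, x \in h c.
  by rewrite inE => /orP[]; [exists false | exists true].
(* By maximality: a vertex complete to one side and without neighbours on the other could be added
   to that other side. *)
have h_max c z : z \notin A :|: B -> {in h c, forall y, e z y} ->
    exists2 b, b \in h (~~ c) & e z b.
  move=> zAB full; apply/exists_inP; rewrite -[[exists _ in _, _]]negbK negb_exists_in.
  apply/negP => /forall_inP none; move: zAB; rewrite inE negb_or => /andP[zA zB].
  have indep' (X : {set T}) : {in X &, forall x y, ~~ e x y} ->
      (forall y, y \in X -> ~~ e z y) -> {in z |: X &, forall x y, ~~ e x y}.
    move=> X_indep X_none x y; rewrite !inE => /predU1P[->|xX] /predU1P[->|yX].
    - by rewrite e_irr.
    - exact: X_none.
    - by rewrite e_sym; apply: X_none.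
    - exact: X_indep.
  case: c full none => full none.
    have /max /= : P (z |: A, B).
      rewrite /P /= sB (subset_trans sA (subsetUr _ _)) !andbT; apply/induced_bicliqueP; split=> //.
        exact: indep'.
      by move=> x y; rewrite !inE => /predU1P[->|xA] yB; [apply: full | apply: AB].
    by rewrite cardsU1 zA ltnn.
  have /max /= : P (A, z |: B).
    rewrite /P /= sA (subset_trans sB (subsetUr _ _)) !andbT; apply/induced_bicliqueP; split=> //.
      exact: indep'.
    by move=> x y xA; rewrite !inE => /predU1P[->|yB]; [rewrite e_sym; apply: full | apply: AB].
  by rewrite cardsU1 zB addnCA ltnn.
(* If the biclique covered all vertices, two vertices of [A] would be false twins. *)
have [d dO] : exists d, d \in ~: (A :|: B).
  apply/set0Pn/negP => /eqP O0; have [k k_inj kA] := distinct_members (h_3 false).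
  apply: (no_twins (k ord0) (k ord_max)); split; last split.
  - by apply/eqP => /k_inj.
  - exact: A_indep.
  - move=> z; have : z \in A :|: B by rewrite -[_ \in _]negbK -in_setC O0 inE.
    rewrite inE => /orP[zA|zB]; last by rewrite !AB.
    by rewrite (negPf (A_indep _ _ _ zA)) ?(negPf (A_indep _ _ _ zA)).
pose D := component e (~: (A :|: B)) d; pose Bd := neighbours D (A :|: B).
have D_sub x : x \in D -> x \notin A :|: B.
  by move/(subsetP (component_sub e dO)); rewrite inE.
have D_conn : connected_set e D := component_connected e_sym dO.
have Dh c : [disjoint D & h c].
  rewrite disjoints_subset; apply/subsetP => x /D_sub; rewrite !inE.
  by apply: contra => /h_sub; rewrite inE.
move: u w; apply: nonadjacent_pair_cases.
- by move=> u w; apply: separable_sym.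
- by move=> i i' ii'; apply: (@flat_embedding t T e h); rewrite ?ii' //; apply: h_indep.
move=> i j a w nadj nout.
have [flat|] := boolP ((i != w.1) || (odd a.+1 == odd (depth w.2))).
  by apply: (@flat_embedding t T e h) => //=; apply: h_indep.
rewrite negb_or => /andP[_ w_par].
have {}w_par : odd (depth w.2) = odd a by move: w_par => /=; do 2!case: odd.
(* An outside vertex complete to a side already separates the pair, by [switch_embedding] with the
   sides relabelled so that this side becomes the one of index [false]. *)
have nonfull c z : separable e (i, Some (j, a)) w \/
    (z \notin A :|: B -> exists2 y, y \in h c & ~~ e z y).
  have [full|] := boolP [forall y in h c, e z y]; last first.
    by rewrite negb_forall_in => /exists_inP nf; right.
  have [zAB|zAB] := boolP (z \in A :|: B); first by right.
  have [b bh ezb] := h_max c z zAB (fun y => forall_inP full y).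
  left; apply: (@switch_embedding t T e (fun b => h (b (+) c)) z b) => //.
  - by move=> b'; rewrite addNb; apply: h_host.
  - by move=> x y; apply: h_indep.
  - by move=> y yh; apply: (forall_inP full).
  - by apply/eqP => E; rewrite E (h_sub _ _ bh) in zAB.
have [/existsP[c Bd_big]|none] := boolP [exists c, 1 < #|Bd :&: h c|].
  case/card_gt1P: Bd_big => a1 [a2 []]; rewrite !inE => /andP[/andP[_ /exists_inP[d1 d1D e1]] a1h].
  move=> /andP[/andP[_ /exists_inP[d2 d2D e2]] a2h] a12.
  have [/existsP[z]|all_nonfull] := boolP [exists z, (z \in D) && [forall y in h c, e z y]].
    case/andP=> zD /forall_inP full; case: (nonfull c z) => // /(_ (D_sub z zD)) [y yh].
    by rewrite full.
  have [||x [s [k1 [y [[s_path s_last k1h yh] [exk1 nexy s_uniq]]]]]] :=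
    attachment D_conn (Dh c) a1h a2h a12 d1D d2D e1 e2.
  - move=> x xD; apply/exists_inP; rewrite -negb_forall_in; apply: contra all_nonfull => full.
    by apply/existsP; exists x; rewrite xD.
  - exact: h_3.
  (* The shift [c (+) odd a] puts the inner neighbour and [w], whose depth has the parity of [a], on
     the side [h c]. *)
  apply: (@leg_embedding t T e h c (c (+) odd a) x s k1 y) => //; first by rewrite addbK.
  by rewrite w_par addbK.
(* Now the component has at most one neighbour on each side. These form a clique of at most two
   vertices, against [neighbours_not_cutset]. *)
have small c : #|Bd :&: h c| <= 1.
  by rewrite leqNgt; apply: contra none => big; apply/existsP; exists c.
have Bd_clique : is_clique e Bd.
  move=> x y xB yB xy.
  have [cx xh] : exists c, x \in h c by apply: h_ex; move: xB; rewrite inE => /andP[].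
  have [cy yh] : exists c, y \in h c by apply: h_ex; move: yB; rewrite inE => /andP[].
  have [E|neq] := eqVneq cy (~~ cx); first by apply: (h_join cx); rewrite -?E.
  have E : cy = cx by case: cx cy neq {xh yh} => -[].
  have /card_le1_eqP/(_ x y) E' := small cx.
  by move: xy; rewrite E' ?eqxx // inE ?xB ?yB // -E.
have := @neighbours_not_cutset (A :|: B) d.
rewrite -in_setC dO -/D -/Bd => /(_ isT) Bd_big.
have : 2 < #|Bd|.
  apply: Bd_big => //; apply: leq_trans (h_3 false) _.
  exact: subset_leq_card (subsetUl _ _).
have : #|Bd| <= #|Bd :&: h false| + #|Bd :&: h true|.
  apply: leq_trans (leq_card_setU _ _); apply: subset_leq_card; rewrite -setIUr.
  by apply/subsetP => x xB; rewrite inE xB; move: xB; rewrite inE => /andP[].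
by have := small false; have := small true; clear; lia.
Qed.

End Dense.

(** * Ramsey's theorem *)

Section Ramsey.
Variables (T : finType) (e : rel T).
Hypotheses (e_sym : symmetric e) (e_irr : irreflexive e).

(** Induction on [a + b]: when both are positive, a vertex [x] of [A] has at least [2 ^ (a + b - 1)]
    neighbours or at least that many non-neighbours in [A :\ x], and [x] extends the set found there
    if that set is of the matching kind. *)
Lemma ramsey a b (A : {set T}) :
  2 ^ (a + b) <= #|A| ->
  exists S : {set T}, S \subset A /\
    (a <= #|S| /\ is_clique e S \/ b <= #|S| /\ {in S &, forall x y, ~~ e x y}).
Proof.
have [n] := ubnP (a + b); elim: n a b A => // n IHn [|a] b A le_n A_big.
  by exists set0; split; [apply: sub0set | left; split=> // x y; rewrite inE].
case: b => [|b] in le_n A_big *.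
  by exists set0; split; [apply: sub0set | right; split=> // x y; rewrite inE].
have [x xA] : exists x, x \in A by apply/card_gt0P; apply: leq_trans A_big; rewrite expn_gt0.
pose N := [set y in A :\ x | e x y]; pose M := [set y in A :\ x | ~~ e x y].
have card_NM : #|A| = (#|N| + #|M|).+1.
  rewrite (cardsD1 x) xA add1n -(cardsID [set y | e x y] (A :\ x)); congr (_ + _).+1.
    by apply: eq_card => y; rewrite !inE.
  by apply: eq_card => y; rewrite !inE andbC.
have NA y : y \in N -> y \in A /\ e x y by rewrite !inE => /andP[/andP[_ ->] ->].
have MA y : y \in M -> y \in A /\ ~~ e x y by rewrite !inE => /andP[/andP[_ ->] ->].
have xN : x \notin N by rewrite !inE eqxx.
have xM : x \notin M by rewrite !inE eqxx.
have [N_big|N_small] := leqP (2 ^ (a + b.+1)) #|N|.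
  have [|S [SN [[S_big S_cl]|[S_big S_ind]]]] := IHn a b.+1 N _ N_big.
  - by move: le_n; clear; lia.
  - exists (x |: S); split.
      apply/subsetP => y; rewrite !inE => /predU1P[-> //|/(subsetP SN)/NA[] //].
    left; split; first by rewrite cardsU1 (contra (subsetP SN x)).
    move=> y z; rewrite !inE => /predU1P[->|yS] /predU1P[->|zS]; rewrite ?eqxx //.
    + by move=> _; case/NA: (subsetP SN _ zS).
    + by move=> _; rewrite e_sym; case/NA: (subsetP SN _ yS).
    + exact: S_cl.
  - exists S; split; last by right.
    by apply: subset_trans SN _; apply/subsetP => y /NA[].
have M_big : 2 ^ (a.+1 + b) <= #|M|.
  move: A_big N_small; rewrite card_NM addSn !addnS addSn expnS; clear; lia.
have [|S [SM [[S_big S_cl]|[S_big S_ind]]]] := IHn a.+1 b M _ M_big.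
- by move: le_n; clear; lia.
- exists S; split; last by left.
  by apply: subset_trans SM _; apply/subsetP => y /MA[].
- exists (x |: S); split.
    apply/subsetP => y; rewrite !inE => /predU1P[-> //|/(subsetP SM)/MA[] //].
  right; split; first by rewrite cardsU1 (contra (subsetP SM x)).
  move=> y z; rewrite !inE => /predU1P[->|yS] /predU1P[->|zS]; rewrite ?e_irr //.
  + by case/MA: (subsetP SM _ zS).
  + by rewrite e_sym; case/MA: (subsetP SM _ yS).
  + exact: S_ind.
Qed.

(** A biclique as a subgraph: in contrast to [induced_biclique], edges inside [A] or inside [B] are
    allowed. *)
Definition has_biclique (n : nat) : Prop :=
  exists A B : {set T}, [/\ n <= #|A|, n <= #|B| & {in A & B, forall x y, e x y}].

Lemma has_biclique_fun n (f g : nat -> T) :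
  (forall x y, x < n -> y < n -> f x = f y -> x = y) ->
  (forall x y, x < n -> y < n -> g x = g y -> x = y) ->
  (forall x y, x < n -> y < n -> e (f x) (g y)) -> has_biclique n.
Proof.
move=> f_inj g_inj efg.
exists [set f x | x : 'I_n], [set g x | x : 'I_n]; split.
- by rewrite card_imset ?card_ord // => x y /f_inj E; apply: ord_inj; apply: E.
- by rewrite card_imset ?card_ord // => x y /g_inj E; apply: ord_inj; apply: E.
- by move=> x y /imsetP[i _ ->] /imsetP[j _ ->]; apply: efg.
Qed.

Lemma biclique_cases n :
  has_biclique (2 ^ (n + n)) ->
  (exists K : {set T}, n <= #|K| /\ is_clique e K) \/
  (exists A B : {set T}, [/\ n <= #|A|, n <= #|B| & induced_biclique e A B]).
Proof.
case=> A [B [/ramsey[S [SA [[S_big S_cl]|[S_big S_ind]]]] B_big AB]]; first by left; exists S.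
case/ramsey: B_big => R [RB [[R_big R_cl]|[R_big R_ind]]]; first by left; exists R.
right; exists S, R; split=> //; apply/induced_bicliqueP; split=> // x y xS yR.
by apply: AB; [apply: (subsetP SA) | apply: (subsetP RB)].
Qed.

End Ramsey.

(** * Chords of spiders *)

Section Spiders.
Variables (T : finType) (e : rel T).
Hypothesis e_sym : symmetric e.

(** Arms are functions on [nat] of which only the values up to [n] count, so that cutting and
    shifting need no change of type. *)
Definition arm (W : {set T}) (n : nat) (l : nat -> T) : Prop :=
  [/\ forall i, i < n -> e (l i) (l i.+1), forall i, i <= n -> l i \in W &
      forall i i', l i = l i' -> i <= n -> i' <= n -> i = i'].

Definition apart (a b : nat) (l m : nat -> T) : Prop :=
  forall i i', l i = m i' -> i <= a -> i' <= b -> i = 0 /\ i' = 0.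

Record spider (W : {set T}) (a b c : nat) (l m k : nat -> T) : Prop := Spider {
  spider_lm : l 0 = m 0;
  spider_lk : l 0 = k 0;
  arm_l : arm W a l;
  arm_m : arm W b m;
  arm_k : arm W c k;
  apart_lm : apart a b l m;
  apart_lk : apart a c l k;
  apart_mk : apart b c m k }.

Lemma arm_weaken W n n' l : n' <= n -> arm W n l -> arm W n' l.
Proof.
move=> le_n [l_e l_W l_inj]; split.
- by move=> i lt_i; apply: l_e; apply: leq_trans le_n.
- by move=> i le_i; apply: l_W; apply: leq_trans le_n.
- by move=> i i' E le_i le_i'; apply: (l_inj i i' E); apply: leq_trans le_n.
Qed.

Lemma apart_weaken a b a' b' l m : a' <= a -> b' <= b -> apart a b l m -> apart a' b' l m.
Proof.
by move=> le_a le_b lm i i' E le_i le_i'; apply: (lm i i' E); [apply: leq_trans le_a|apply: leq_trans le_b].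
Qed.

Lemma apart_sym a b l m : apart a b l m -> apart b a m l.
Proof. by move=> lm i i' E le_i le_i'; case: (lm i' i (esym E) le_i' le_i). Qed.

Lemma spider_weaken W a b c a' b' c' l m k :
  a' <= a -> b' <= b -> c' <= c -> spider W a b c l m k -> spider W a' b' c' l m k.
Proof.
move=> le_a le_b le_c [lm lk al am ak plm plk pmk].
by split; rewrite ?(arm_weaken _ al) ?(arm_weaken _ am) ?(arm_weaken _ ak) //;
  eauto using arm_weaken, apart_weaken.
Qed.

Lemma spider_swap W a b c l m k : spider W a b c l m k -> spider W b a c m l k.
Proof.
move=> [lm lk al am ak plm plk pmk].
by split; rewrite -?lm //; apply: apart_sym.
Qed.

(** The chord bypasses the [d] vertices of the arm between its ends. *)
Lemma spider_shortcut W n b c l m k q d :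
  spider W n b c l m k -> q + d < n -> e (l q) (l (q + d).+1) ->
  spider W (n - d) b c (fun i => if i <= q then l i else l (i + d)) m k.
Proof.
move=> [lm lk [l_e l_W l_inj] am ak plm plk pmk] lt_n eq_l.
have apart_l b' m' : apart n b' l m' ->
    apart (n - d) b' (fun i => if i <= q then l i else l (i + d)) m'.
  by move=> p i i'; case: leqP => le_q /p; lia.
split=> //; [split|exact: apart_l|exact: apart_l].
- move=> i lt_i; case: (ltngtP i q) => [lt_q|lt_q|->].
  + by apply: l_e; lia.
  + by rewrite addSn; apply: l_e; lia.
  + by rewrite addSn.
- by move=> i le_i; case: leqP => _; apply: l_W; lia.
- by move=> i i'; do 2?case: leqP => ?; move=> /l_inj; lia.
Qed.

Lemma arm_shift W n l s : arm W n l -> s <= n -> arm W (n - s) (fun i => l (s + i)).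
Proof.
move=> [l_e l_W l_inj] le_s; split.
- by move=> i lt_i; rewrite addnS; apply: l_e; lia.
- by move=> i le_i; apply: l_W; lia.
- by move=> i i' /l_inj; lia.
Qed.

(* The new centre is [l s]: its arms run along [l] in both directions, and
   through the chord to [l q] and back towards the old centre into [m]. *)
Lemma spider_recentre W n b c l m k q s :
  spider W n b c l m k -> q < s -> s <= n -> e (l q) (l s) ->
  spider W (n - s) (s - q.+1) b (fun i => l (s + i)) (fun i => l (s - i))
    (fun i => if i == 0 then l s else if i <= q.+1 then l (q.+1 - i) else m (i - q.+1)).
Proof.
move=> [lm lk al [m_e m_W m_inj] ak plm plk pmk] lt_q le_s eq_l.
have [l_e l_W l_inj] := al.
split; rewrite ?addn0 ?subn0 //=.
- exact: arm_shift.
- split.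
  + move=> i lt_i; have -> : s - i = (s - i.+1).+1 by lia.
    by rewrite e_sym; apply: l_e; lia.
  + by move=> i le_i; apply: l_W; lia.
  + by move=> i i' /l_inj; lia.
- split.
  + move=> [|i] lt_i /=; first by rewrite subSS subn0 e_sym.
    rewrite !ltnS; case: (ltngtP i q) => [lt_i_q|gt_i_q|->].
    * rewrite e_sym; have -> : q.+1 - i.+1 = (q.+1 - i.+2).+1 by lia.
      by apply: l_e; lia.
    * by rewrite !subSS subSn ?(ltnW gt_i_q) //; apply: m_e; lia.
    * by rewrite !subSS subnn subSn // subnn lm; apply: m_e; lia.
  + by move=> i le_i; do 2?case: ifP => ?; [apply: l_W|apply: l_W|apply: m_W]; lia.
  + move=> i i'; do 2?case: ifP => ?; do 2?case: ifP => ?;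
      first [by move=> /l_inj; lia | by move=> /m_inj; lia |
             by move=> /plm; lia | by move=> /esym/plm; lia].
- by move=> i i' /l_inj; lia.
- by move=> i i'; do 2?case: ifP => ?; [move=> /l_inj|move=> /l_inj|move=> /plm]; lia.
- by move=> i i'; do 2?case: ifP => ?; [move=> /l_inj|move=> /l_inj|move=> /plm]; lia.
Qed.

(* The new centre is [m a]: its arms run along [m] away from the old centre,
   through the chord to [l b] and on along [l], and along [m] through the old
   centre into [k]. *)
Lemma spider_cross W n n' c l m k a b :
  spider W n n' c l m k -> 0 < a -> 0 < b -> a <= n' -> b <= n -> e (m a) (l b) ->
  spider W (n' - a) (n - b) c (fun i => m (a + i))
    (fun i => if i == 0 then m a else l (b + i.-1))
    (fun i => if i <= a then m (a - i) else k (i - a)).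
Proof.
move=> [lm lk [l_e l_W l_inj] am [k_e k_W k_inj] plm plk pmk] a_gt0 b_gt0 le_a le_b eab.
have [m_e m_W m_inj] := am.
split; rewrite ?addn0 ?subn0 //=.
- exact: arm_shift.
- split.
  + move=> [|i] lt_i /=; first by rewrite addn0.
    by rewrite addnS; apply: l_e; lia.
  + by move=> i le_i; case: ifP => ?; [apply: m_W|apply: l_W]; lia.
  + by move=> i i'; do 2?case: ifP => ?; [|move=> /esym /plm|move=> /plm|move=> /l_inj]; lia.
- split.
  + move=> i lt_i; case: (ltngtP i a) => [lt_i_a|gt_i_a|->].
    * rewrite e_sym; have -> : a - i = (a - i.+1).+1 by lia.
      by apply: m_e; lia.
    * by rewrite subSn ?(ltnW gt_i_a) //; apply: k_e; lia.
    * by rewrite subnn subSn // subnn -lm lk; apply: k_e; lia.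
  + by move=> i le_i; case: ifP => ?; [apply: m_W|apply: k_W]; lia.
  + by move=> i i'; do 2?case: ifP => ?; [move=> /m_inj|move=> /pmk|move=> /esym/pmk|move=> /k_inj]; lia.
- by move=> i i'; case: ifP => ?; [move=> /m_inj|move=> /esym/plm]; lia.
- by move=> i i'; case: ifP => ?; [move=> /m_inj|move=> /pmk]; lia.
- by move=> i i'; do 2?case: ifP => ?; [move=> /m_inj|move=> /pmk|move=> /plm|move=> /plk]; lia.
Qed.

End Spiders.

(** * From forced chords to large bicliques *)

Section Closure.
Variables (T : finType) (e : rel T).
Hypothesis e_sym : symmetric e.
Variables (W : {set T}) (t : nat).

(** Used as a shortcut, the chord yields a spider whose own forced chord joins [l q] to a vertex [d]
    further out on [l]. Repetition gives a progression of neighbours of [l q]; the summand [t] keeps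
    the shortened arm long enough. *)
Lemma same_leg_progression q d :
  (forall l m k, spider e W t t t l m k -> e (l q) (l (q + d).+1)) -> q + d < t ->
  forall j n l m k, spider e W n t t l m k -> (q + d).+1 + j * d + t <= n ->
  e (l q) (l ((q + d).+1 + j * d)).
Proof.
move=> chord lt_t; elim=> [|j IHj] n l m k sp le_n.
  rewrite mul0n addn0; apply: (chord l m k); apply: (spider_weaken _ _ _ sp) => //.
  by apply: leq_trans le_n; rewrite leq_addl.
have le_tn : t <= n by apply: leq_trans le_n; rewrite leq_addl.
have sp' : spider e W (n - d) t t (fun i => if i <= q then l i else l (i + d)) m k.
  apply: (spider_shortcut sp); first by apply: leq_trans lt_t le_tn.
  by apply: (chord l m k); apply: (spider_weaken _ _ _ sp).
have {}le_n : (q + d).+1 + j * d + t <= n - d.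
  by move: le_n; rewrite mulSn; clear; lia.
have := IHj _ _ _ _ sp' le_n; rewrite leqnn.
have -> : (q + d).+1 + j * d <= q = false by apply/negbTE; rewrite -ltnNge; clear; lia.
by congr (e _ (l _)); rewrite mulSn; clear; lia.
Qed.

(** Each neighbour [l s] of [l q] found above becomes a new centre, and the progression for the new
    spider joins [l (s + q)] to vertices further out. Since [s] runs through a progression with
    difference [d], all these neighbours fall into a common progression. *)
Lemma same_leg_biclique q d M l m k :
  (forall l m k, spider e W t t t l m k -> e (l q) (l (q + d).+1)) -> 0 < d -> q + d < t ->
  spider e W (7 * t + 2 * M * t + t * t) t t l m k -> has_biclique e M.
Proof.
set n := 7 * t + 2 * M * t + t * t => chord d_gt0 lt_t sp; pose p := (q + d).+1.
have le_dt : d <= t by move: lt_t; clear; lia.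
have le_d x : x <= t + 2 * M -> x * d <= t * t + 2 * M * t.
  by move=> le_x; apply: leq_trans (leq_mul le_x le_dt) _; rewrite mulnDl.
have lin x y : x * d = y * d -> x = y.
  by move=> E; apply/eqP; rewrite -(eqn_pmul2r d_gt0) E.
have l_inj x y : l x = l y -> x <= n -> y <= n -> x = y by case: (arm_l sp) => _ _ inj; apply: inj.
(* Row [x] comes from the centre [l s] with [s = p + (t + x) * d] and reaches column [y] after
   [M + y - x] steps. The offset [t] makes the arm running back from [l s] long enough; the offset
   [M] keeps the number of steps non-negative. *)
apply: (@has_biclique_fun _ e M (fun x => l (p + q + (t + x) * d))
                                 (fun y => l (2 * p + (t + M + y) * d))).
- move=> x y lt_x lt_y /l_inj; have := @lin (t + x) (t + y).
  have := le_d (t + x); have := le_d (t + y).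
  by move: lt_x lt_y lt_t; rewrite /n /p; clear; lia.
- move=> x y lt_x lt_y /l_inj; have := @lin (t + M + x) (t + M + y).
  have := le_d (t + M + x); have := le_d (t + M + y).
  by move: lt_x lt_y lt_t; rewrite /n /p; clear; lia.
move=> x y lt_x lt_y; pose s := p + (t + x) * d.
have le_s : s + t <= n.
  by have := le_d (t + x); move: lt_x lt_t; rewrite /n /s /p; clear; lia.
have ge_d z : z <= z * d by rewrite leq_pmulr.
have lqs : e (l q) (l s).
  by apply: (same_leg_progression chord lt_t sp).
have sp' : spider e W (n - s) t t (fun i => l (s + i)) (fun i => l (s - i))
    (fun i => if i == 0 then l s else if i <= q.+1 then l (q.+1 - i) else m (i - q.+1)).
  apply: (spider_weaken _ _ _ (spider_recentre e_sym sp _ _ lqs)) => //.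
  - by have := ge_d (t + x); rewrite /s /p; clear; lia.
  - by rewrite /s /p; clear; lia.
  - by move: le_s; clear; lia.
have := same_leg_progression chord lt_t (j := M + y - x) sp'.
have -> : s + ((q + d).+1 + (M + y - x) * d) = 2 * p + (t + M + y) * d.
  have -> : t + M + y = (t + x) + (M + y - x) by move: lt_x; clear; lia.
  by rewrite mulnDl /s /p; clear; lia.
have -> : s + q = p + q + (t + x) * d by rewrite /s; clear; lia.
apply; rewrite -(leq_add2l s) subnKC; last by move: le_s; clear; lia.
have : s + p + (M + y - x) * d = 2 * p + (t + M + y) * d.
  have -> : t + M + y = (t + x) + (M + y - x) by move: lt_x; clear; lia.
  by rewrite mulnDl /s /p; clear; lia.
have := le_d (t + M + y).
by move: lt_x lt_y lt_t; rewrite /n /p; clear; lia.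
Qed.

Section CrossLegs.
Variables (p q : nat).
Hypotheses (p_gt0 : 0 < p) (q_gt0 : 0 < q) (le_pt : p <= t) (le_qt : q <= t).
Hypothesis chord : forall l m k, spider e W t t t l m k -> e (l p) (m q).

(* The edges [m a] - [l b] so obtained all satisfy a + b = p + q modulo p + q - 1;
   the two steps (al, be) and (be, al) span a lattice of rank 2, which contains a
   large grid of such edges. *)
Lemma cross_step n l m k a b :
  spider e W n n t l m k -> 0 < a -> 0 < b -> a + t <= n -> b + t <= n -> e (m a) (l b) ->
  e (m (a + q)) (l (b + p.-1)) /\ e (m (a + p)) (l (b + q.-1)).
Proof.
move=> sp a_gt0 b_gt0 le_a le_b eab.
have le_an : a <= n by apply: leq_trans le_a; rewrite leq_addr.
have le_bn : b <= n by apply: leq_trans le_b; rewrite leq_addr.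
have sp' := spider_cross e_sym sp a_gt0 b_gt0 le_an le_bn eab.
have le_ta : t <= n - a by rewrite leq_subRL.
have le_tb : t <= n - b by rewrite leq_subRL.
have {}sp' := spider_weaken le_ta le_tb (leqnn t) sp'.
have := chord sp'; have := chord (spider_swap sp').
by rewrite /= !gtn_eqF // => h1 h2; split=> //; rewrite e_sym.
Qed.

(** The steps of [cross_step] together with their mirror images, obtained by exchanging [l] and [m],
    include both ([al], [be]) and ([be], [al]); take [i] of the one and [j] of the other. *)
Lemma cross_reach al be n l m k i j :
  (al = q /\ be = p.-1) \/ (al = p.-1 /\ be = q) \/
  (al = p /\ be = q.-1) \/ (al = q.-1 /\ be = p) ->
  spider e W n n t l m k -> (i + j) * t + 2 * t <= n ->
  e (m (q + i * al + j * be)) (l (p + i * be + j * al)).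
Proof.
move=> al_be sp.
have step a b : 0 < a -> 0 < b -> a + t <= n -> b + t <= n -> e (m a) (l b) ->
    e (m (a + al)) (l (b + be)) /\ e (m (a + be)) (l (b + al)).
  move=> a_gt0 b_gt0 le_a le_b eab.
  have [h1 h2] := cross_step sp a_gt0 b_gt0 le_a le_b eab.
  have eba : e (l b) (m a) by rewrite e_sym.
  have [h3 h4] := cross_step (spider_swap sp) b_gt0 a_gt0 le_b le_a eba.
  rewrite e_sym in h3; rewrite e_sym in h4.
  by case: al_be => [[-> ->]|[[-> ->]|[[-> ->]|[-> ->]]]].
have le_al : al <= t by move: al_be le_pt le_qt; clear; lia.
have le_be : be <= t by move: al_be le_pt le_qt; clear; lia.
have bound i' j' c : i' + j' <= c -> i' * al + j' * be <= c * t /\ i' * be + j' * al <= c * t.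
  move=> le_c; have {}le_c : (i' + j') * t <= c * t by rewrite leq_mul2r le_c orbT.
  rewrite mulnDl in le_c; split; apply: leq_trans le_c; apply: leq_add;
    by rewrite leq_mul2l ?le_al ?le_be orbT.
elim: i => [|i IHi].
  elim: j => [|j IHj] le_n.
    rewrite !mul0n !addn0 e_sym; apply: (chord (l := l) (m := m) (k := k)).
    by apply: (spider_weaken _ _ _ sp); move: le_n; clear; lia.
  have le_n' : (0 + j) * t + 2 * t + t <= n by move: le_n; rewrite mulnDl mulSn; clear; lia.
  have [b1 b2] := bound 0 j (0 + j) (leqnn _).
  have ga : 0 < q + 0 * al + j * be by move: q_gt0; clear; lia.
  have gb : 0 < p + 0 * be + j * al by move: p_gt0; clear; lia.
  have gc : q + 0 * al + j * be + t <= n by move: b1 le_n' le_qt; clear; lia.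
  have gd : p + 0 * be + j * al + t <= n by move: b2 le_n' le_pt; clear; lia.
  have ge : (0 + j) * t + 2 * t <= n by move: le_n'; clear; lia.
  have [_] := step _ _ ga gb gc gd (IHj ge).
  by rewrite !mulSn; congr (is_true (e (m _) (l _))); clear; lia.
move=> le_n.
have le_n' : (i + j) * t + 2 * t + t <= n by move: le_n; rewrite addSn mulSn; clear; lia.
have [b1 b2] := bound i j (i + j) (leqnn _).
have ga : 0 < q + i * al + j * be by move: q_gt0; clear; lia.
have gb : 0 < p + i * be + j * al by move: p_gt0; clear; lia.
have gc : q + i * al + j * be + t <= n by move: b1 le_n' le_qt; clear; lia.
have gd : p + i * be + j * al + t <= n by move: b2 le_n' le_pt; clear; lia.
have ge : (i + j) * t + 2 * t <= n by move: le_n'; clear; lia.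
have [+ _] := step _ _ ga gb gc gd (IHi ge).
by rewrite !mulSn; congr (is_true (e (m _) (l _))); clear; lia.
Qed.

Lemma cross_legs_biclique M l m k :
  spider e W (4 * M * t * t + 2 * t) (4 * M * t * t + 2 * t) t l m k -> has_biclique e M.
Proof.
set n := 4 * M * t * t + 2 * t => sp.
(* One of the two pairs of steps has distinct entries: if [p.-1 = q], then [p] and [q.-1] differ. *)
have [al [be [lt_ab al_be]]] : exists al be, be < al /\
    ((al = q /\ be = p.-1) \/ (al = p.-1 /\ be = q) \/
     (al = p /\ be = q.-1) \/ (al = q.-1 /\ be = p)).
  case: (ltngtP p.-1 q) => [lt_pq|gt_pq|E].
  - by exists q, p.-1; split=> //; left.
  - by exists p.-1, q; split=> //; right; left.
  - by exists p, q.-1; split; [move: p_gt0 q_gt0 E; clear; lia | right; right; left].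
have le_al : al <= t by move: al_be le_pt le_qt; clear; lia.
(* With [I x y] steps of one kind and [I y x] of the other, [y] cancels from the position on [m] and
   [x] from the position on [l]. Both become linear with slope [al * al - be * be], so each row
   meets each column in an edge. *)
pose I x y := be * (M - y) + x * al.
have le_I x y : x < M -> I x y <= 2 * M * t.
  move=> lt_x; rewrite /I.
  have h1 : be * (M - y) <= t * M by apply: leq_mul; [apply: leq_trans (ltnW lt_ab) le_al|apply: leq_subr].
  have h2 : x * al <= M * t by apply: leq_mul; rewrite // ltnW.
  by move: h1 h2; rewrite [t * M]mulnC; clear; lia.
pose c := al * be * M + be * be * M.
have E x y : x < M -> y < M -> I x y * al + I y x * be = c + x * (al * al - be * be).
  move=> lt_x lt_y; rewrite /I /c.
  have [g Eg] : exists g, al = be + g by exists (al - be); rewrite subnKC // ltnW.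
  have [x' Ex] : exists x', M = x + x' by exists (M - x); rewrite subnKC // ltnW.
  have [y' Ey] : exists y', M = y + y' by exists (M - y); rewrite subnKC // ltnW.
  have -> : M - x = x' by rewrite Ex addKn.
  have -> : M - y = y' by rewrite Ey addKn.
  have -> : al * al - be * be = 2 * be * g + g * g.
    by rewrite Eg; clear; nia.
  have -> : al * be * M = al * be * (y + y') by rewrite Ey.
  have -> : be * be * M = be * be * (x + x') by rewrite Ex.
  by rewrite Eg; clear; nia.
have d_gt0 : 0 < al * al - be * be by rewrite subn_gt0; apply: ltn_mul.
have lin x y : x * (al * al - be * be) = y * (al * al - be * be) -> x = y.
  by move=> Exy; apply/eqP; rewrite -(eqn_pmul2r d_gt0) Exy.
have le_n x y : x < M -> y < M -> (I x y + I y x) * t + 2 * t <= n.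
  move=> lt_x lt_y; rewrite leq_add2r leq_mul2r; apply/orP; right.
  by have := le_I x y lt_x; have := le_I y x lt_y; clear; lia.
have le_pos x y : x < M -> y < M -> c + x * (al * al - be * be) + 2 * t <= n.
  move=> lt_x lt_y; rewrite -(E x y lt_x lt_y); apply: leq_trans (le_n x y lt_x lt_y).
  rewrite leq_add2r mulnDl; apply: leq_add; rewrite leq_mul2l; apply/orP; right => //.
  by apply: leq_trans (ltnW lt_ab) le_al.
have edge x y : x < M -> y < M ->
    e (m (q + (c + x * (al * al - be * be)))) (l (p + (c + y * (al * al - be * be)))).
  move=> lt_x lt_y; have := cross_reach al_be sp (le_n x y lt_x lt_y).
  by rewrite -[q + _ + _]addnA -[p + _ + _]addnA (E x y) // [I x y * be + _]addnC (E y x).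
have m_inj x y : m x = m y -> x <= n -> y <= n -> x = y by case: (arm_m sp) => _ _ inj; apply: inj.
have l_inj x y : l x = l y -> x <= n -> y <= n -> x = y by case: (arm_l sp) => _ _ inj; apply: inj.
apply: (has_biclique_fun _ _ edge) => x y lt_x lt_y.
  move=> /m_inj inj; apply: lin; have := le_pos x y lt_x lt_y; have := le_pos y x lt_y lt_x.
  by move: inj le_qt; clear; lia.
move=> /l_inj inj; apply: lin; have := le_pos x y lt_x lt_y; have := le_pos y x lt_y lt_x.
by move: inj le_pt; clear; lia.
Qed.

End CrossLegs.
End Closure.

(** * Separation by many disjoint spiders *)

Section Sparse.
Variables (T : finType) (e : rel T).
Hypothesis e_sym : symmetric e.

(** Permutes the roles of the arms, so that the legs of a given pair of vertices can be put on [l]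
    and [m]. *)
Definition leg3 (j j' : 'I_3) (l m k : nat -> T) (x : 'I_3) : nat -> T :=
  if x == j then l else if x == j' then m else k.

Definition spider_map t (j j' : 'I_3) (l m k : nat -> T) (v : option ('I_3 * 'I_t)) : T :=
  if v is Some (x, b) then leg3 j j' l m k x b.+1 else l 0.

Lemma leg3_0 W a b c l m k j j' x : spider e W a b c l m k -> leg3 j j' l m k x 0 = l 0.
Proof. by case=> lm lk _ _ _ _ _ _; rewrite /leg3; do 2?case: ifP. Qed.

Lemma leg3_arm W t l m k j j' x : spider e W t t t l m k -> arm e W t (leg3 j j' l m k x).
Proof. by case=> _ _ al am ak _ _ _; rewrite /leg3; do 2?case: ifP. Qed.

Lemma leg3_apart W t l m k j j' x x' :
  spider e W t t t l m k -> j != j' -> x != x' ->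
  apart t t (leg3 j j' l m k x) (leg3 j j' l m k x').
Proof.
case=> _ _ _ _ _ lm lk mk jj' xx'; have ml := apart_sym lm.
have kl := apart_sym lk; have km := apart_sym mk; rewrite /leg3.
case: (eqVneq x j) => [Ex|nx]; case: (eqVneq x' j) => [Ex'|nx'].
- by rewrite Ex Ex' eqxx in xx'.
- by case: ifP.
- by case: ifP.
case: (eqVneq x j') => [Ey|ny]; case: (eqVneq x' j') => [Ey'|ny'] //.
  by rewrite Ey Ey' eqxx in xx'.
move: nx nx' ny ny' jj' xx'; rewrite -!val_eqE /=.
by have := ltn_ord j; have := ltn_ord j'; have := ltn_ord x; have := ltn_ord x'; clear; lia.
Qed.

Lemma spider_map_in W t l m k j j' (v : option ('I_3 * 'I_t)) :
  spider e W t t t l m k -> spider_map j j' l m k v \in W.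
Proof.
move=> sp; case: v => [[x b]|] /=; first by case: (leg3_arm j j' x sp) => _ + _; apply.
by case: (arm_l sp) => _ + _; apply.
Qed.

Lemma spider_map_inj W t l m k j j' :
  spider e W t t t l m k -> j != j' -> injective (@spider_map t j j' l m k).
Proof.
move=> sp jj'; have leg_neq x (b : 'I_t) : leg3 j j' l m k x b.+1 = l 0 -> False.
  by rewrite -(leg3_0 j j' x sp); case: (leg3_arm j j' x sp) => _ _ inj /inj h; have := h (ltn_ord b) isT.
move=> [[x b]|] [[x' b']|] //=; first last.
- by move=> /esym /leg_neq.
- by move=> /leg_neq.
have [<-|xx'] := eqVneq x x'.
  case: (leg3_arm j j' x sp) => _ _ inj /inj E.
  by congr (Some (_, _)); apply: ord_inj; apply: succn_inj; apply: E; apply: ltn_ord.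
by move=> /(leg3_apart sp jj' xx') h; have [] := h (ltn_ord b) (ltn_ord b').
Qed.

Lemma family_embedding t (W : 'I_t -> {set T}) (l m k : 'I_t -> nat -> T) (j j' : 'I_3) :
  j != j' -> (forall i, spider e (W i) t t t (l i) (m i) (k i)) ->
  (forall i i' v, v \in W i -> v \in W i' -> i = i') ->
  embedding e (@spider_adj t) (fun z => spider_map j j' (l z.1) (m z.1) (k z.1) z.2).
Proof.
move=> jj' sp disj; split.
  move=> [i v] [i' v'] /= E.
  have Ei : i = i'.
    by apply: disj (spider_map_in j j' v (sp i)) _; rewrite E; apply: spider_map_in.
  by congr (_, _); rewrite // -Ei in E *; apply: spider_map_inj E.
have step i (v v' : option ('I_3 * 'I_t)) : spider_step v v' ->
    e (spider_map j j' (l i) (m i) (k i) v) (spider_map j j' (l i) (m i) (k i) v').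
  case: v v' => [[x b]|] [[x' b']|] //=.
    move=> /andP[/eqP <- /eqP Eb]; case: (leg3_arm j j' x (sp i)) => h _ _.
    by have := h b.+1; rewrite -Eb => h'; apply: h'; apply: (ltn_ord b').
  move=> /eqP Eb; rewrite -(leg3_0 j j' x' (sp i)); have {}Eb : nat_of_ord b' = 0 := Eb.
  rewrite Eb.
  by case: (leg3_arm j j' x' (sp i)) => + _ _; apply; rewrite -Eb ltn_ord.
move=> [i v] [i' v']; rewrite /spider_adj /= => /andP[/eqP <- /orP[|]]; first exact: step.
by rewrite e_sym; apply: step.
Qed.

Definition spider_family (r n : nat) (W : nat -> {set T}) (l m k : nat -> nat -> T) : Prop :=
  (forall i, i < r -> spider e (W i) n n n (l i) (m i) (k i)) /\
  (forall i i' v, i < r -> i' < r -> v \in W i -> v \in W i' -> i = i').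

(** The arm length needed by [same_leg_biclique] plus the one needed by [cross_legs_biclique]. *)
Definition sparse_length t M := 7 * t + 2 * M * t + t * t + (4 * M * t * t + 2 * t).

(** For vertices of different copies, [M] spiders are reserved for each; if no choice separates, the
    images form a biclique. Within one copy, failure forces a chord in every [t]-spider inside
    [W i], and these chords multiply to a biclique. *)
Lemma sparse_separable t M W l m k (u w : spider_vert t) :
  ~ has_biclique e M -> spider_family (t + 2 * M) (sparse_length t M) W l m k ->
  u != w -> ~~ spider_adj u w -> separable e u w.
Proof.
move=> no_biclique [sp disj] neq nadj.
have le_t : t <= sparse_length t M by rewrite /sparse_length; clear; lia.
have spt i : i < t + 2 * M -> spider e (W i) t t t (l i) (m i) (k i).
  by move=> /sp; apply: spider_weaken.
have lt_t (i : 'I_t) : i < t + 2 * M by apply: leq_trans (ltn_ord i) (leq_addr _ _).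
have [E1|neq1] := eqVneq u.1 w.1; last first.
  pose pos i (v : option ('I_3 * 'I_t)) := spider_map ord0 ord_max (l i) (m i) (k i) v.
  have pos_W i v : i < t + 2 * M -> pos i v \in W i by move=> lt_i; apply: spider_map_in (spt i lt_i).
  pose f x := pos (t + x) u.2; pose g y := pos (t + M + y) w.2.
  have lt_f x : x < M -> t + x < t + 2 * M by clear; lia.
  have lt_g x : x < M -> t + M + x < t + 2 * M by clear; lia.
  have [/existsP[x /existsP[y nexy]]|all_adj] :=
    boolP [exists x : 'I_M, exists y : 'I_M, ~~ e (f x) (g y)].
    (* The copies not containing [u] or [w] keep the spiders of index below [t]. *)
    pose s (i : 'I_t) : nat := if i == u.1 then t + x else if i == w.1 then t + M + y else i.
    have lt_s i : s i < t + 2 * M.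
      by rewrite /s; do 2?case: ifP => _ //; [apply: lt_f | apply: lt_g].
    have s_inj i i' : s i = s i' -> i = i'.
      have := ltn_ord x; have := ltn_ord i; have := ltn_ord i'; rewrite /s.
      case: (eqVneq i u.1) => [->|_]; case: (eqVneq i' u.1) => [->|_] //.
      - by case: ifP => _; clear; lia.
      - by case: ifP => _; clear; lia.
      case: (eqVneq i w.1) => [->|_]; case: (eqVneq i' w.1) => [->|_] //.
      - by clear; lia.
      - by clear; lia.
      - by move=> _ _ _ /ord_inj.
    have emb := @family_embedding t (W \o s) (l \o s) (m \o s) (k \o s) ord0 ord_max isT
      (fun i => spt _ (lt_s i)) (fun i i' v vi vi' => s_inj i i' (disj _ _ v (lt_s i) (lt_s i') vi vi')).
    exists (fun z => pos (s z.1) z.2); split; first exact: emb.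
    by rewrite /s eqxx eq_sym (negPf neq1) eqxx.
  case: no_biclique; apply: (@has_biclique_fun _ e M f g).
  - move=> x x' lt_x lt_x' Ef; have := disj _ _ (f x) (lt_f x lt_x) (lt_f x' lt_x').
    by rewrite {2}Ef !pos_W ?lt_f // => /(_ isT isT) /addnI.
  - move=> x x' lt_x lt_x' Ef; have := disj _ _ (g x) (lt_g x lt_x) (lt_g x' lt_x').
    by rewrite {2}Ef !pos_W ?lt_g // => /(_ isT isT) /addnI.
  move=> x y lt_x lt_y; move: all_adj; rewrite negb_exists => /forallP/(_ (Ordinal lt_x)).
  by rewrite negb_exists => /forallP/(_ (Ordinal lt_y)); rewrite negbK.
have pair_sep (u' w' : spider_vert t) : u' != w' -> ~~ spider_adj u' w' ->
    u'.1 = w'.1 -> separable e u' w'; last exact: pair_sep.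
move: u' w'; apply: nonadjacent_pair_cases.
- by move=> u' w' h E; apply: separable_sym => //; apply: h.
- by move=> i i' ii' /= E; rewrite E eqxx in ii'.
move=> i j a [i' v] nadj' nout /= Ei; subst i'.
have [//|nsep] := classic (separable e (i, Some (j, a)) (i, v)); case: no_biclique.
(* Any spider inside [W i] may replace the one of index [i] without meeting the others, so
   non-separability puts the chord into it. *)
have chord (j' : 'I_3) l0 m0 k0 : j != j' -> spider e (W i) t t t l0 m0 k0 ->
    e (l0 a.+1) (spider_map j j' l0 m0 k0 v).
  move=> jj' sp0; apply/negPn/negP => nadj0; case: nsep.
  pose upd (f : nat -> nat -> T) (f0 : nat -> T) (x : 'I_t) := if x == i then f0 else f x.
  have sp_upd (x : 'I_t) : spider e (W x) t t t (upd l l0 x) (upd m m0 x) (upd k k0 x).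
    by rewrite /upd; case: eqP => [->|_]; [apply: sp0 | apply: spt].
  have emb := @family_embedding t (fun x => W x) _ _ _ j j' jj' sp_upd
    (fun x x' y yx yx' => ord_inj (disj _ _ y (lt_t x) (lt_t x') yx yx')).
  exists (fun z => spider_map j j' (upd l l0 z.1) (upd m m0 z.1) (upd k k0 z.1) z.2).
  by split; first exact: emb; rewrite /= /upd eqxx /leg3 eqxx.
have [j0 jj0] : exists j0 : 'I_3, j != j0.
  by case: (eqVneq j ord0) => [->|]; [exists ord_max | exists ord0].
have lt_a := ltn_ord a.
(* Here [v] is at position [q] on the leg of the other vertex, with [q = 0] for the centre, and [d]
   vertices lie between the two. *)
have same q d : q + d = a -> 0 < d ->
    (forall l0 m0 k0, spider_map j j0 l0 m0 k0 v = l0 q) -> has_biclique e M.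
  move=> Ea d_gt0 v_pos; apply: (@same_leg_biclique _ _ e_sym (W i) t q d M (l i) (m i) (k i)) => //.
  - by move=> l0 m0 k0 sp0; rewrite Ea e_sym -(v_pos l0 m0 k0); apply: chord.
  - by rewrite Ea.
  - by apply: spider_weaken (sp i (lt_t i)); rewrite // /sparse_length; clear; lia.
case: v nadj' nout {nsep} chord same => [[x b]|] nadj' nout chord same; last first.
  apply: (same 0 a) => //; move: nadj'; rewrite /spider_adj /= eqxx /=.
  by rewrite lt0n -[val a]/(nat_of_ord a).
have lt_b := ltn_ord b.
have [Ex|xj] := eqVneq x j.
  move: nadj' nout; rewrite Ex /spider_adj /outward /= !eqxx /= -ltnNge.
  rewrite -[val a]/(nat_of_ord a) -[val b]/(nat_of_ord b) => nab lt_ba.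
  apply: (same b.+1 (a - b.+1)).
  - by rewrite subnKC.
  - by move: nab lt_ba; clear; lia.
  - by move=> l0 m0 k0; rewrite /= /leg3 Ex eqxx.
apply: (@cross_legs_biclique _ _ e_sym (W i) t a.+1 b.+1 _ _ _ _ _ M (l i) (m i) (k i)) => //.
  move=> l0 m0 k0 sp0; have jx : j != x by rewrite eq_sym.
  by have := chord x l0 m0 k0 jx sp0; rewrite /= /leg3 (negPf xj) eqxx.
by apply: spider_weaken (sp i (lt_t i)); rewrite // /sparse_length; clear; lia.
Qed.


End Sparse.

(** * Treewidth of graphs without long spiders *)

Lemma sorted_ltn_gap (s : seq nat) i j :
  sorted ltn s -> i <= j -> j < size s -> nth 0 s i + (j - i) <= nth 0 s j.
Proof.
move=> s_sorted; elim: j => [|j IHj]; first by rewrite leqn0 => /eqP ->; rewrite addn0.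
rewrite leq_eqVlt => /predU1P[-> _|le_ij lt_j]; first by rewrite subnn addn0.
have lt_nth : nth 0 s j < nth 0 s j.+1.
  by apply: (sorted_ltn_nth ltn_trans) => //; rewrite inE // ltnW.
by have := IHj le_ij (ltnW lt_j); move: lt_nth le_ij; clear; lia.
Qed.

Section PathSpider.
Variables (T : finType) (e : rel T).
Hypothesis e_sym : symmetric e.

(* A vertex [P_a] of the path, far from its end and from [P_b], is the centre:
   two arms run along [P], the third one through [D] to [P_b] and then along [P]. *)
Lemma path_spider (P : seq T) (D : {set T}) n :
  sorted e P -> uniq P -> connected_set e D -> (forall x, x \in P -> x \notin D) ->
  3 * n + 2 <= #|[set p in P | [exists x in D, e x p]]| ->
  exists l m k, spider e setT n n n l m k.
Proof.
move=> P_sorted P_uniq D_conn PD big.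
have [x0 x0P] : exists x, x \in P.
  by case: P {P_sorted P_uniq PD} big => [|x P]; [rewrite (eq_card0 (A := _)) ?addn2 // => x; rewrite !inE | exists x; rewrite mem_head].
pose att p := [exists x in D, e x p].
pose s := [seq i <- iota 0 (size P) | att (nth x0 P i)].
have s_sorted : sorted ltn s by apply: sorted_filter (iota_ltn_sorted _ _); apply: ltn_trans.
have s_att i : i < size s -> nth 0 s i < size P /\ att (nth x0 P (nth 0 s i)).
  by move=> /(mem_nth 0); rewrite mem_filter mem_iota => /andP[-> /andP[_ ->]].
have s_big : 3 * n + 1 < size s.
  have : #|[set p in P | att p]| <= size [seq p <- P | att p].
    by apply: leq_trans (card_size _); apply: subset_leq_card; apply/subsetP => p; rewrite !inE mem_filter andbC.
  rewrite -{2}(mkseq_nth x0 P) /mkseq filter_map size_map => h.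
  by apply: leq_trans h; apply: leq_trans big; rewrite addn1 addn2.
(* Attachments number [n] and [2 * n + 1], counted from 0: this leaves [n] path vertices before [a],
   [n] between [a] and [b], and [n] after [b]. *)
pose a := nth 0 s n; pose b := nth 0 s (2 * n + 1).
have le_na : n <= a.
  by have := @sorted_ltn_gap s 0 n s_sorted isT; rewrite -/a; move: s_big; clear; lia.
have lt_ab : a + n < b.
  have := @sorted_ltn_gap s n (2 * n + 1) s_sorted; rewrite -/a -/b.
  by move: s_big; clear; lia.
have [lt_bP b_att] : b < size P /\ att (nth x0 P b) by apply: s_att; move: s_big; clear; lia.
have [lt_aP a_att] : a < size P /\ att (nth x0 P a) by apply: s_att; move: s_big; clear; lia.
have le_bn : b + n < size P.
  have := @sorted_ltn_gap s (2 * n + 1) (3 * n + 1) s_sorted; rewrite -/b.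
  by have [] := s_att _ s_big; move: s_big; clear; lia.
case/exists_inP: a_att => da daD ea; case/exists_inP: b_att => db dbD eb.
have [c [c_path c_last c_uniq cD]] := connected_set_path D_conn daD dbD.
pose x i := nth x0 P i; pose y i := nth x0 (da :: c) i; pose r := (size c).+1.
have x_e i : i.+1 < size P -> e (x i) (x i.+1) by apply: (sortedP x0 P_sorted).
have x_inj i i' : x i = x i' -> i < size P -> i' < size P -> i = i'.
  by move=> E lt_i lt_i'; apply/eqP; rewrite -(nth_uniq x0 lt_i lt_i' P_uniq); apply/eqP.
have y_inj i i' : y i = y i' -> i < r -> i' < r -> i = i'.
  by move=> E lt_i lt_i'; apply/eqP; rewrite -(nth_uniq x0 (s := da :: c) lt_i lt_i' c_uniq); apply/eqP.
have y_e i : i.+1 < r -> e (y i) (y i.+1).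
  by apply: (sortedP x0 (s := da :: c)).
have xy i i' : x i = y i' -> i < size P -> i' < r -> False.
  move=> E lt_i lt_i'; have := PD _ (mem_nth x0 lt_i); rewrite -/(x i) E cD //.
  exact: mem_nth.
have y_first : e (x a) (y 0) by rewrite e_sym.
have y_last : e (y r.-1) (x b).
  by rewrite /y /r -[_.-1]/((size (da :: c)).-1) nth_last /= c_last.
(* The third arm consists of [x a], the [r] vertices of the path in [D], and [P] from [x b] on,
   which has index [r.+1]. *)
exists (fun i => x (a + i)), (fun i => x (a - i)),
  (fun i => if i == 0 then x a else if i <= r then y i.-1 else x (b + (i - r.+1))).
have r_gt0 : 0 < r by [].
move: (size P) le_bn lt_bP lt_aP x_e x_inj xy => N le_bn lt_bP lt_aP x_e x_inj xy.
clearbody x y r a b.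
clear - e_sym le_na lt_ab N le_bn lt_bP lt_aP x_e x_inj xy y_inj y_e y_first y_last r_gt0.
split; rewrite ?addn0 ?subn0 //=.
- split=> [i lt_i|//|i i' /x_inj].
    by rewrite addnS; apply: x_e; move: lt_i lt_ab le_bn; clear; lia.
  by move: lt_ab le_bn; clear; lia.
- split=> [i lt_i|//|i i' /x_inj].
    rewrite e_sym; have -> : a - i = (a - i.+1).+1 by move: lt_i le_na; clear; lia.
    by apply: x_e; move: lt_ab lt_bP; clear; lia.
  by move: lt_ab lt_bP le_na; clear; lia.
- split=> [[|i] lt_i|//|i i'] /=.
  + by rewrite r_gt0.
  + case: (ltngtP i.+1 r) => [lt_ir|gt_ir|E].
    * exact: y_e.
    * have -> : i.+2 - r.+1 = (i.+1 - r.+1).+1 by move: gt_ir; clear; lia.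
      by rewrite addnS; apply: x_e; move: lt_i le_bn; clear; lia.
    * by rewrite E subnn addn0 -[i]/(i.+1.-1) E.
  + do 2?case: ifP => ?; do 2?case: ifP => ?;
      first [lia | by move=> /x_inj; lia | by move=> /y_inj; lia |
             by move=> /xy; lia | by move=> /esym/xy; lia].
- by move=> i i' /x_inj; lia.
- by move=> i i'; do 2?case: ifP => ?; [move=> /x_inj|move=> /xy|move=> /x_inj]; lia.
- by move=> i i'; do 2?case: ifP => ?; [move=> /x_inj|move=> /xy|move=> /x_inj]; lia.
Qed.


End PathSpider.

(** A tree decomposition of the subgraph induced by [W], with a root bag containing [R] at which
    another one can be attached. Here [c] bounds the bag size, not the width. *)
Definition root_decomposition (T : finType) (e : rel T) (W R : {set T}) (c : nat) : Prop :=
  exists (I : finType) (r : rel I) (B : I -> {set T}) (i0 : I),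
    [/\ is_tree r, forall i, B i \subset W, R \subset B i0 & forall i, #|B i| <= c] /\
    [/\ forall v, v \in W -> exists i, v \in B i,
        forall v w, v \in W -> w \in W -> e v w -> exists i, (v \in B i) && (w \in B i) &
        forall v i j, v \in B i -> v \in B j ->
          connect [rel a b | [&& r a b, v \in B a & v \in B b]] i j].

(** * Joining trees and gluing decompositions *)

Section TreeJoin.
Variables (I1 I2 : finType) (r1 : rel I1) (r2 : rel I2) (i1 : I1) (i2 : I2).

Definition tree_join : rel (I1 + I2) := fun x y =>
  match x, y with
  | inl a, inl b => r1 a b
  | inr a, inr b => r2 a b
  | inl a, inr b | inr b, inl a => (a == i1) && (b == i2)
  end.

Lemma card_rel (I : finType) (r : rel I) :
  #|[set p : I * I | r p.1 p.2]| = \sum_x \sum_y r x y.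
Proof.
by rewrite -sum1_card pair_bigA /= big_mkcond /=; apply: eq_bigr => p _; rewrite inE; case: r.
Qed.

Lemma connect_map (I J : finType) (r : rel I) (s : rel J) (f : I -> J) x y :
  (forall a b, r a b -> s (f a) (f b)) -> connect r x y -> connect s (f x) (f y).
Proof.
move=> hom /connectP[p p_path ->]; elim: p x p_path => [|a p IHp] x /=.
  by rewrite connect0.
by case/andP => /hom/connect1 xa /IHp; apply: connect_trans.
Qed.

(** For trees with [n1] and [n2] nodes the count of ordered adjacent pairs is
    [2 * (n1 - 1) + 2 * (n2 - 1) + 2], the last 2 being the joining edge. *)
Lemma tree_join_is_tree : is_tree r1 -> is_tree r2 -> is_tree tree_join.
Proof.
case=> sym1 irr1 pos1 conn1 card1 [sym2 irr2 pos2 conn2 card2].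
have sym12 : symmetric tree_join by case=> a [] b //=.
have to1 x : connect tree_join (inl i1) x.
  case: x => x; first exact: (connect_map (f := inl) (s := tree_join)) (conn1 i1 x).
  apply: (connect_trans (y := inr i2)); first by apply: connect1; rewrite /= !eqxx.
  exact: (connect_map (f := inr) (s := tree_join)) (conn2 i2 x).
split=> //.
- by case=> a /=.
- by apply/card_gt0P; exists (inl i1).
- move=> x y; apply: connect_trans (to1 y).
  by rewrite (sym_connect_sym sym12).
rewrite card_rel big_sumType /=.
under eq_bigr do rewrite big_sumType /=.
under [X in _ + X]eq_bigr do rewrite big_sumType /=.
rewrite !big_split /= -!card_rel card1 card2 card_sum.
have -> : \sum_a \sum_b ((a == i1) && (b == i2) : nat) = 1.
  rewrite (bigD1 i1) //= (bigD1 i2) //= !eqxx big1 => [|b /negPf ->]; last by rewrite ?andbF.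
  by rewrite big1 // => a /negPf ->; rewrite big1.
have -> : \sum_b \sum_a ((a == i1) && (b == i2) : nat) = 1.
  rewrite (bigD1 i2) //= (bigD1 i1) //= !eqxx big1 => [|b /negPf ->] //.
  by rewrite big1 // => a /negPf ->; rewrite big1 // => b _; rewrite andbF.
by move: pos1 pos2; clear; lia.
Qed.

End TreeJoin.

Section Decompositions.
Variables (T : finType) (e : rel T).
Hypothesis e_sym : symmetric e.

Lemma root_decomposition_bag (R : {set T}) c : #|R| <= c -> root_decomposition e R R c.
Proof.
move=> le_c; exists unit, (fun _ _ => false), (fun _ => R), tt; split; split=> //.
- split=> //; first by rewrite card_unit.
  + by case=> -[]; apply: connect0.
  + by rewrite card_unit muln0; apply: eq_card0 => p; rewrite inE.
- by move=> v w vR wR _; exists tt; rewrite vR.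
- by move=> v [] [] _ _; apply: connect0.
Qed.

(** The root bags are joined by an edge. A vertex of both parts lies in both roots, so the bags
    containing it stay connected; by the last hypothesis every edge lies within one part. *)
Lemma root_decomposition_glue (W1 R1 W2 R2 : {set T}) c :
  root_decomposition e W1 R1 c -> root_decomposition e W2 R2 c ->
  W1 :&: W2 \subset R1 -> W1 :&: W2 \subset R2 ->
  (forall v w, v \in W1 -> w \in W2 -> e v w -> (v \in W2) || (w \in W1)) ->
  root_decomposition e (W1 :|: W2) R1 c.
Proof.
case=> [I1 [r1 [B1 [i1 [[tree1 sub1 root1 card1] [vert1 edge1 conn1]]]]]].
case=> [I2 [r2 [B2 [i2 [[tree2 sub2 root2 card2] [vert2 edge2 conn2]]]]]] W_R1 W_R2 cross.
pose B (x : I1 + I2) := match x with inl i => B1 i | inr i => B2 i end.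
have vertB v : v \in W1 :|: W2 -> exists i, v \in B i.
  by rewrite inE => /orP[/vert1[i]|/vert2[i]]; [exists (inl i)|exists (inr i)].
have edgeB1 v w : v \in W1 -> w \in W1 -> e v w -> exists i, (v \in B i) && (w \in B i).
  by move=> v1 w1 /(edge1 _ _ v1 w1)[i]; exists (inl i).
have edgeB2 v w : v \in W2 -> w \in W2 -> e v w -> exists i, (v \in B i) && (w \in B i).
  by move=> v2 w2 /(edge2 _ _ v2 w2)[i]; exists (inr i).
exists (I1 + I2)%type, (tree_join r1 r2 i1 i2), B, (inl i1); split; split=> //.
- exact: tree_join_is_tree.
- case=> i; first exact: subset_trans (sub1 i) (subsetUl _ _).
  exact: subset_trans (sub2 i) (subsetUr _ _).
- by case.
- move=> v w; rewrite !inE => /orP[v1|v2] /orP[w1|w2] evw.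
  + exact: edgeB1.
  + by case/orP: (cross v w v1 w2 evw) => ?; [apply: edgeB2|apply: edgeB1].
  + rewrite e_sym in evw; case/orP: (cross w v w1 v2 evw) => ?; rewrite e_sym in evw.
      exact: edgeB2.
    exact: edgeB1.
  + exact: edgeB2.
move=> v; set rv := [rel a b | _].
have rv_sym : symmetric rv.
  have [sym1 _ _ _ _] := tree1; have [sym2 _ _ _ _] := tree2.
  move=> x y; rewrite /rv /= [(v \in B y) && _]andbC; congr (_ && _).
  by case: x y => a [] b //=.
have in1 i j : v \in B1 i -> v \in B1 j -> connect rv (inl i) (inl j).
  by move=> vi vj; apply: (connect_map _ (conn1 v i j vi vj)).
have in2 i j : v \in B2 i -> v \in B2 j -> connect rv (inr i) (inr j).
  by move=> vi vj; apply: (connect_map _ (conn2 v i j vi vj)).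
have in12 i j : v \in B1 i -> v \in B2 j -> connect rv (inl i) (inr j).
  move=> vi vj; have vW : v \in W1 :&: W2 by rewrite inE (subsetP (sub1 i)) ?(subsetP (sub2 j)).
  have v1 : v \in B1 i1 by apply: (subsetP root1); apply: (subsetP W_R1).
  have v2 : v \in B2 i2 by apply: (subsetP root2); apply: (subsetP W_R2).
  apply: connect_trans (in1 _ _ vi v1) _; apply: connect_trans (in2 _ _ v2 vj).
  by apply: connect1; rewrite /rv /= !eqxx v1 v2.
move=> [i|i] [j|j] /= vi vj; [exact: in1 | exact: in12 | | exact: in2].
by rewrite (sym_connect_sym rv_sym); apply: in12.
Qed.

(* [P] is the path built so far and [R] the bag on top of which [C] has to be
   decomposed; a component [D] of [C] is attached below the bag consisting of
   its neighbours in [R] and the next vertex of the path. *)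
Lemma search_decomposition n (P : seq T) (R C : {set T}) :
  (forall l m k, ~ spider e setT n n n l m k) ->
  sorted e P -> uniq P -> (forall x, x \in P -> x \notin C) -> {subset R <= P} ->
  (forall x y, x \in C -> e x y -> y \in C :|: R) -> #|R| <= 3 * n + 2 ->
  root_decomposition e (C :|: R) R (3 * n + 2).
Proof.
move=> no_spider; have [s] := ubnP #|C|.
elim: s P R C => // s IHs P R C /ltnSE le_s P_sorted P_uniq PC RP C_closed R_small.
have [->|/set0Pn[d dC]] := eqVneq C set0; first by rewrite set0U; apply: root_decomposition_bag.
pose D := component e C d; pose A := [set p in R | [exists x in D, e x p]].
have dD : d \in D := mem_component e C d.
have DC x : x \in D -> x \in C := subsetP (component_sub e dC) x.
have CR x : x \in C -> x \notin R.
  by move=> xC; apply/negP => /RP/PC; rewrite xC.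
have D_closed x y : x \in D -> e x y -> y \in D :|: A.
  move=> xD exy; have := C_closed x y (DC x xD) exy; rewrite !inE => /orP[yC|yR].
    by have := component_closed dC xD exy yC; rewrite inE => ->.
  by rewrite yR; apply/orP; right; apply/exists_inP; exists x.
have AR : A \subset R by apply/subsetP => y; rewrite inE => /andP[].
(* With one more neighbour on the path, [path_spider] would yield a forbidden spider. *)
have A_small : #|A| <= 3 * n + 1.
  rewrite -ltnS -addnS leqNgt; apply/negP => A_big.
  have [||l [m [k sp]]] := path_spider e_sym P_sorted P_uniq (component_connected e_sym dC) _ _ (n := n); last exact: no_spider sp.
  - by move=> x /PC; apply: contra => /DC.
  - apply: leq_trans (ltnSE A_big) _; apply: subset_leq_card; apply/subsetP => y.
    by rewrite !inE => /andP[/RP -> ->].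
(* Backtracking: the path is cut down to the part from its first vertex in [A] on, and a neighbour
   [v] of that vertex in [D] is put in front. All of [A] stays on the path. If [A] is empty, a new
   path starts at [d]. *)
have [v [P' [vD vP'_sorted P'_uniq P'P AP']]] : exists v P',
    [/\ v \in D, sorted e (v :: P'), uniq P', {subset P' <= P} & {subset A <= P'}].
  have [A0|/set0Pn[a0 a0A]] := eqVneq A set0.
    by exists d, [::]; split=> // y; rewrite A0 inE.
  have hasA : has (mem A) P.
    by apply/hasP; exists a0; [apply: RP; apply: (subsetP AR) | ].
  pose i := find (mem A) P; pose a := nth a0 P i.
  have aA : a \in A := nth_find a0 hasA.
  have lt_i : i < size P by rewrite -has_find.
  have [v vD eva] : exists2 v, v \in D & e v a.
    by move: aA; rewrite inE => /andP[_ /exists_inP].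
  have P'P : {subset drop i P <= P} by apply: mem_drop.
  exists v, (drop i P); split=> //.
  - by rewrite (drop_nth a0 lt_i) /= eva -/a -[path e a _]/(sorted e (a :: _)) -drop_nth // drop_sorted.
  - exact: drop_uniq.
  - move=> y yA; have := RP y (subsetP AR y yA); rewrite -{1}(cat_take_drop i P) mem_cat.
    case/orP=> // y_take; have : has (mem A) (take i P) by apply/hasP; exists y.
    by rewrite has_take ?ltnn // ltnW.
have vC := DC v vD.
have vP' : v \notin P' by apply/negP => /P'P/PC; rewrite vC.
have vA : v \notin A by apply/negP => /(subsetP AR); rewrite (negPf (CR _ vC)).
(* The bag [v |: A] separates the rest of [D] from all other vertices. *)
have decD : root_decomposition e ((D :\ v) :|: (v |: A)) (v |: A) (3 * n + 2).
  apply: (IHs (v :: P')) => //.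
  - apply: leq_trans le_s; apply: (@leq_trans #|D|).
      by rewrite [X in _ <= X](cardsD1 v) vD.
    by apply: subset_leq_card; apply/subsetP.
  - by rewrite /= vP'.
  - move=> x; rewrite in_cons in_setD1 => /predU1P[->|/P'P/PC xC]; first by rewrite eqxx.
    by rewrite negb_and (contra (DC x) xC) orbT.
  - by move=> x; rewrite in_setU in_set1 in_cons => /orP[->|/AP' ->]; rewrite ?orbT.
  - move=> x y; rewrite in_setD1 => /andP[_ xD] /(D_closed x y xD).
    by rewrite !in_setU in_setD1 in_set1 => /orP[->|->]; case: (y == v); rewrite ?orbT.
  - by rewrite cardsU1 vA; move: A_small; clear; lia.
have decC : root_decomposition e ((C :\: D) :|: R) R (3 * n + 2).
  apply: (IHs P) => //.
  - apply: leq_trans le_s; apply: proper_card; apply/properP; split; first exact: subsetDl.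
    by exists d; rewrite // in_setD dD.
  - by move=> x /PC; rewrite in_setD negb_and => ->; rewrite orbT.
  - move=> x y; rewrite in_setD => /andP[xD xC] exy; have := C_closed x y xC exy.
    rewrite !in_setU in_setD => /orP[yC|->]; last by rewrite orbT.
    rewrite yC andbT; case: (boolP (y \in D)) => [yD|//].
    by case/negP: xD; apply: component_closed dC yD _ xC; rewrite e_sym.
have -> : C :|: R = ((C :\: D) :|: R) :|: ((D :\ v) :|: (v |: A)).
  apply/setP => x; rewrite [in LHS]in_setU; apply/orP/idP.
    rewrite !in_setU in_setD in_setD1 in_set1.
    by case=> ->; rewrite ?orbT // andbT; case: (x \in D); case: (x == v); rewrite ?orbT.
  rewrite !in_setU in_setD in_setD1 in_set1 => /orP[/orP[/andP[_ ->]|->]|]; [by left|by right|].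
  by case/or3P=> [/andP[_ /DC]|/eqP ->|/(subsetP AR)]; [left|left|right].
have inter : ((C :\: D) :|: R) :&: ((D :\ v) :|: (v |: A)) \subset A.
  apply/subsetP => x; rewrite in_setI !in_setU in_setD in_setD1 in_set1.
  case/andP => h /or3P[/andP[_ xD]|/eqP Ex|//].
    by move: h; rewrite xD /= (negPf (CR x (DC x xD))).
  by move: h; rewrite Ex vD /= (negPf (CR v vC)).
apply: root_decomposition_glue decC decD _ _ _.
- exact: subset_trans inter AR.
- by apply: subset_trans inter _; apply: subsetUr.
- move=> x y; rewrite !in_setU !in_setD1 !in_setD !in_set1 => hx hy exy.
  have : (y \in D) || (y \in A).
    by case/or3P: hy => [/andP[_ ->]|/eqP ->|->]; rewrite ?vD ?orbT.
  case/orP=> [yD|yA]; last by rewrite (subsetP AR y yA) !orbT.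
  have := D_closed y x yD; rewrite e_sym in_setU => /(_ exy) /orP[xD|->]; last by rewrite !orbT.
  by rewrite xD andbT; case: eqP.
Qed.

End Decompositions.

(** * Packings of disjoint spiders *)

Section Packing.
Variables (T : finType) (e : rel T).

Lemma arm_within (W V : {set T}) n l :
  arm e W n l -> (forall i, i <= n -> l i \in V) -> arm e V n l.
Proof. by case=> l_e _ l_inj lV; split. Qed.

Lemma spider_support (W : {set T}) n l m k :
  spider e W n n n l m k ->
  exists V : {set T}, [/\ V \subset W, #|V| <= 3 * n.+1 & spider e V n n n l m k].
Proof.
case=> lm lk al am ak plm plk pmk.
pose img (f : nat -> T) := [set f i | i : 'I_n.+1].
have img_mem f i : i <= n -> f i \in img f.
  by move=> le_i; apply/imsetP; exists (Ordinal (le_i : i < n.+1)).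
have img_sub f : arm e W n f -> img f \subset W.
  by case=> _ fW _; apply/subsetP => _ /imsetP[i _ ->]; apply: fW; rewrite -ltnS.
have img_card f : #|img f| <= n.+1.
  by apply: leq_trans (leq_imset_card _ _) _; rewrite card_ord.
exists (img l :|: img m :|: img k); split.
- by rewrite !subUset !img_sub.
- have lm_card := leq_trans (leq_card_setU (img l) (img m)) (leq_add (img_card l) (img_card m)).
  apply: leq_trans (leq_card_setU _ _) _; apply: leq_trans (leq_add lm_card (img_card k)) _.
  by clear; lia.
split=> //; [apply: arm_within al _|apply: arm_within am _|apply: arm_within ak _] => i le_i;
  by rewrite !inE img_mem ?orbT.
Qed.

(** Greedy: delete the vertices of a spider and continue in the rest. If none is left before [r]
    have been found, the deleted vertices form [X]. *)
Lemma spider_packing r n (W : {set T}) :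
  (exists Ws l m k, spider_family e r n Ws l m k /\ forall i, i < r -> Ws i \subset W) \/
  (exists X : {set T}, #|X| <= r * (3 * n.+1) /\
     forall l m k, ~ spider e (W :\: X) n n n l m k).
Proof.
elim: r W => [|r IHr] W.
  (* [T] may be empty, and then there is not even an empty family of functions. *)
  have [[l [m [k _]]]|none] := classic (exists l m k, spider e W n n n l m k).
    by left; exists (fun=> set0), (fun=> l), (fun=> m), (fun=> k); split=> //; split.
  right; exists set0; split; first by rewrite cards0.
  by move=> l m k sp; apply: none; exists l, m, k; rewrite setD0 in sp.
have [[l [m [k /spider_support[V [VW V_small sp]]]]]|none] :=
  classic (exists l m k, spider e W n n n l m k); last first.
  right; exists set0; split; first by rewrite cards0.
  by move=> l m k sp; apply: none; exists l, m, k; rewrite setD0 in sp.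
case: (IHr (W :\: V)) => [[Ws [l' [m' [k' [[sp' disj] sub]]]]]|[X [X_small noX]]].
  left; exists (fun i => if i is i'.+1 then Ws i' else V),
    (fun i => if i is i'.+1 then l' i' else l), (fun i => if i is i'.+1 then m' i' else m),
    (fun i => if i is i'.+1 then k' i' else k); split; last first.
    by case=> // i lt_i; apply: subset_trans (sub i lt_i) (subsetDl _ _).
  have notV i v : i < r -> v \in Ws i -> v \in V -> False.
    by move=> lt_i /(subsetP (sub i lt_i)); rewrite inE => /andP[/negP].
  split; first by case=> // i; apply: sp'.
  case=> [|i] [|i'] v //=.
  - by move=> _ lt_i' vV /(notV _ _ lt_i')/(_ vV).
  - by move=> lt_i _ /(notV _ _ lt_i).
  - by move=> lt_i lt_i' vi vi'; rewrite (disj i i' v).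
right; exists (V :|: X); split; last by move=> l0 m0 k0; rewrite -setDDl; apply: noX.
by apply: leq_trans (leq_card_setU _ _) _; rewrite mulSn leq_add.
Qed.

(** Positive length makes every vertex of an arm an end of an edge, and edges of [restrict e W] have
    both ends in [W]. *)
Lemma spider_of_restrict (W : {set T}) n l m k :
  0 < n -> spider (restrict e W) setT n n n l m k -> spider e W n n n l m k.
Proof.
move=> n_gt0 [lm lk al am ak plm plk pmk].
have arm_restrict f : arm (restrict e W) setT n f -> arm e W n f.
  case=> f_e _ f_inj; split=> //; first by move=> i /f_e /and3P[].
  case=> [|i] le_i; first by case/and3P: (f_e 0 n_gt0).
  by case/and3P: (f_e i le_i).
by split=> //; apply: arm_restrict.
Qed.

Hypothesis e_sym : symmetric e.

(** Decompose the graph without [X], starting the search with an empty path, and add [X] to every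
    bag. Restricting [e] keeps the vertices of [X] as isolated ones, so the vertex type is
    unchanged. *)
Lemma tw_le_of_no_spider (X : {set T}) n c :
  0 < n -> (forall l m k, ~ spider e (~: X) n n n l m k) -> 3 * n + 2 + #|X| <= c.+1 ->
  tw_le e c.
Proof.
move=> n_gt0 no_spider le_c.
have no_spider' l m k : ~ spider (restrict e (~: X)) setT n n n l m k.
  by move/(spider_of_restrict n_gt0); apply: no_spider.
have : root_decomposition (restrict e (~: X)) (setT :|: set0) set0 (3 * n + 2).
  apply: (search_decomposition (restrict_sym e_sym (~: X)) (P := [::])) => //.
  - by move=> x; rewrite inE.
  - by move=> x y; rewrite !inE.
  - by rewrite cards0.
case=> I [r [B [i0 [[tree _ _ small] [vert edge conn]]]]].
exists I, r, (fun i => B i :|: X); split; last first.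
  move=> i; apply: leq_trans (leq_card_setU _ _) _; apply: leq_trans le_c.
  by rewrite leq_add2r.
have vertT v : exists i, v \in B i by apply: vert; rewrite !inE.
have [sym_r _ _ conn_r _] := tree.
split=> //.
- by move=> v; have [i vi] := vertT v; exists i; rewrite inE vi.
- move=> v w evw; have [vX|vX] := boolP (v \in X).
    by have [i wi] := vertT w; exists i; rewrite !inE vX wi orbT.
  have [wX|wX] := boolP (w \in X).
    by have [i vi] := vertT v; exists i; rewrite !inE wX vi orbT.
  have inT (x : T) : x \in setT :|: set0 by rewrite !inE.
  have evw' : restrict e (~: X) v w by rewrite /restrict /= evw !inE vX wX.
  have [i /andP[vi wi]] := edge v w (inT v) (inT w) evw'.
  by exists i; rewrite !inE vi wi.
move=> v i j; have [vX _ _|vX] := boolP (v \in X).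
  apply: connect_sub (conn_r i j) => a b rab; apply: connect1.
  by rewrite /= rab !inE vX !orbT.
rewrite !inE (negPf vX) !orbF => vi vj.
apply: connect_sub (conn v i j vi vj) => a b /and3P[rab va vb]; apply: connect1.
by rewrite /= rab !inE va vb.
Qed.

End Packing.

(** * From separability to the arrow relation, and the bound on treewidth *)

Lemma si_arrow_of_separable t (T : finType) (e : rel T) :
  irreflexive e ->
  (forall u w : spider_vert t, u != w -> ~~ spider_adj u w -> separable e u w) ->
  si_arrow e (@spider_adj t).
Proof.
move=> e_irr sep; apply: si_arrow_of_embeddings => //.
(* An embedding must be exhibited first. For [t = 0] the pattern is empty, and so may be [T]; for
   positive [t] one comes from separating the first vertices of two legs. *)
case: t sep => [|t] sep.
  have empty (z : spider_vert 0) : False by case: z => -[].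
  by exists (fun z => match empty z with end); split=> z; case: (empty z).
by have [//|//|g [g_emb _]] := sep (ord0, Some (ord0, ord0)) (ord0, Some (ord_max, ord0)); exists g.
Qed.

Theorem mainTheorem2 :
  forall t : nat, exists c : nat,
    forall (T : finType) (e : rel T),
      symmetric e -> irreflexive e ->
      in_X t e ->
      (forall x y : T, ~ false_twins e x y) ->
      (forall U : {set T}, #|U| <= 2 -> ~ clique_cutset e U) ->
      complete_graph e \/ tw_le e c.
Proof.
(* [n0] bounds both the order of the pattern and the 6 required of a clique; [M] lets Ramsey's
   theorem find sets of size [n0] in both sides of a biclique. *)
move=> t; pose n0 := #|{: spider_vert t}| + 6; pose M := 2 ^ (n0 + n0).
pose n := (sparse_length t M).+1; pose r := t + 2 * M.
(* Bags of size [3 * n + 2] from the search, enlarged by the at most [r * (3 * n.+1)] vertices of a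
   packing of fewer than [r] spiders. *)
exists (3 * n + 2 + r * (3 * n.+1)) => T e e_sym e_irr GX no_twins no_cutset.
have [|ncomplete] := classic (complete_graph e); [by left | right].
have sep_false : ~ (forall u w : spider_vert t, u != w -> ~~ spider_adj u w -> separable e u w).
  by move=> sep; apply/GX/si_arrow_of_separable.
have le_n0 : #|{: spider_vert t}| <= n0 := leq_addr _ _.
have le_6 : 6 <= n0 := leq_addl _ _.
have no_biclique : ~ has_biclique e M.
  case/(biclique_cases e_sym e_irr) => [[K [K_big K_clique]]|[A [B [A_big B_big AB]]]];
    apply: sep_false => u w neq nadj.
    by apply: (@clique_separable t T e e_sym no_cutset K) => //; apply: leq_trans K_big.
  have le_3 : 3 <= n0 by apply: leq_trans le_6.
  by apply: (@biclique_separable t T e e_sym e_irr no_cutset A B) => //;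
    first [exact: leq_trans A_big | exact: leq_trans B_big].
case: (spider_packing e r n setT) => [[Ws [l [m [k [[sp disj] _]]]]]|[X [X_small noX]]].
  case: sep_false => u w neq nadj.
  apply: (@sparse_separable T e e_sym t M Ws l m k) => //; split=> // i lt_i.
  by apply: spider_weaken (sp i lt_i).
apply: (@tw_le_of_no_spider T e e_sym X n) => //; first by rewrite -setTD.
by rewrite -addnS leq_add2l leqW.
Qed.
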